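(* Let $\mathcal{M}$ be an unbounded graph matroid family. Then $\mathcal{M}$ has the Whitney property if and only if it has the Lovász-Yemini property.
   Context: All graphs are finite and simple (no loops, no parallel edges) and have no isolated vertices; vertex sets are drawn from a fixed countable set such as $\mathbb{N}$. A graph matroid family $\mathcal{M}$ assigns to every such graph $G$ a matroid $\mathcal{M}(G)$ on ground set $E(G)$ such that (i) every graph isomorphism $V(G)\to V(H)$ induces (via its action on edges) an isomorphism $\mathcal{M}(G)\to\mathcal{M}(H)$, and (ii) for every subgraph $H$ of $G$, $\mathcal{M}(H)$ is the restriction of $\mathcal{M}(G)$ to $E(H)$. Write $r(G)$ for the rank of $\mathcal{M}(G)$. A graph $G$ is $\mathcal{M}$-rigid if $r(G)=r(K_{V(G)})$, where $K_V$ is the complete graph on $V$. $\mathcal{M}$ is unbounded if $r(K_n)$ is unbounded as $n\to\infty$. A graph $G$ is $\mathcal{M}$-reconstructible if for every graph $H$ and every matroid isomorphism $\psi:E(G)\to E(H)$ between $\mathcal{M}(G)$ and $\mathcal{M}(H)$, there is a graph isomorphism $\varphi:V(G)\to V(H)$ with $\psi(uv)=\varphi(u)\varphi(v)$ for all $uv\in E(G)$. $\mathcal{M}$ has the Whitney property if there is a nonnegative integer $c$ such that every $c$-connected graph is $\mathcal{M}$-reconstructible; it has the Lovász-Yemini property if there is a nonnegative integer $c$ such that every $c$-connected graph is $\mathcal{M}$-rigid. *)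

(* Defs.v *)
From mathcomp Require Import all_boot all_order.
From mathcomp Require Import finmap.
Set Implicit Arguments. Unset Strict Implicit. Unset Printing Implicit Defensive.
Local Open Scope fset_scope.

(* An edge uv (u <> v) is stored as the normalized pair (min u v, max u v). *)
Definition edge := (nat * nat)%type.
Definition mkedge (u v : nat) : edge := (minn u v, maxn u v).

(* A finite simple graph without isolated vertices on vertices in nat is
   given by its (finite) edge set; its vertex set is the set of endpoints. *)
Definition simple_graph (G : {fset edge}) : Prop := forall e, e \in G -> e.1 < e.2.
Definition V (G : {fset edge}) : {fset nat} :=
  [fset e.1 | e in G] `|` [fset e.2 | e in G].

Definition K (W : {fset nat}) : {fset edge} :=
  [fset e in W `*` W | e.1 < e.2].

Definition emap (phi : nat -> nat) (e : edge) : edge := mkedge (phi e.1) (phi e.2).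

Definition graph_iso (G H : {fset edge}) (phi : nat -> nat) : Prop :=
  {in V G &, injective phi} /\ [fset phi x | x in V G] = V H /\
  {in V G &, forall u v, (mkedge u v \in G) = (mkedge (phi u) (phi v) \in H)}.

Definition is_matroid (E : {fset edge}) (I : {fset edge} -> bool) : Prop :=
  I fset0 /\
  (forall A B, B `<=` E -> A `<=` B -> I B -> I A) /\
  (forall A B, A `<=` E -> B `<=` E -> I A -> I B -> #|` A| < #|` B| ->
     exists2 e, e \in B `\` A & I (e |` A)).

(* A gfamily assigns to each graph G the independence predicate fam G of M(G). *)
Definition gfamily := {fset edge} -> {fset edge} -> bool.

Definition graph_matroid_family (fam : gfamily) : Prop :=
  (forall G, simple_graph G -> is_matroid G (fam G)) /\
  (forall G H phi, simple_graph G -> simple_graph H -> graph_iso G H phi ->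
     forall F, F `<=` G -> fam G F = fam H [fset emap phi e | e in F]) /\
  (forall G H, simple_graph G -> H `<=` G ->
     forall F, F `<=` H -> fam H F = fam G F).

Definition rank (fam : gfamily) (G : {fset edge}) : nat :=
  \max_(F <- fpowerset G | fam G F) #|` F|.

Definition rigid (fam : gfamily) (G : {fset edge}) : Prop :=
  rank fam G = rank fam (K (V G)).

Definition unbounded (fam : gfamily) : Prop :=
  forall m, exists n, m < rank fam (K [fset i | i in iota 0 n]).

Definition matroid_iso (fam : gfamily) (G H : {fset edge}) (psi : edge -> edge) : Prop :=
  {in G &, injective psi} /\ [fset psi e | e in G] = H /\
  (forall F, F `<=` G -> fam G F = fam H [fset psi e | e in F]).

Definition reconstructible (fam : gfamily) (G : {fset edge}) : Prop :=
  forall H psi, simple_graph H -> matroid_iso fam G H psi ->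
  exists phi, graph_iso G H phi /\
    {in V G &, forall u v, mkedge u v \in G -> psi (mkedge u v) = mkedge (phi u) (phi v)}.

(* the subgraph of G induced on W is connected (cut formulation) *)
Definition connected_on (G : {fset edge}) (W : {fset nat}) : Prop :=
  forall S, S `<=` W -> S != fset0 -> S != W ->
    exists u v, [/\ u \in S, v \in W `\` S & mkedge u v \in G].

Definition k_connected (k : nat) (G : {fset edge}) : Prop :=
  k < #|` V G| /\
  forall X, X `<=` V G -> #|` X| < k -> connected_on G (V G `\` X).

Definition whitney_property (fam : gfamily) : Prop :=
  exists c, forall G, simple_graph G -> k_connected c G -> reconstructible fam G.

Definition lovasz_yemini_property (fam : gfamily) : Prop :=
  exists c, forall G, simple_graph G -> k_connected c G -> rigid fam G.

(* Main.v *)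
Require Import Defs.
From mathcomp Require Import all_boot all_order.
From mathcomp Require Import finmap zify.
From Stdlib Require Import Classical.
Set Implicit Arguments. Unset Strict Implicit. Unset Printing Implicit Defensive.
Local Open Scope fset_scope.
Local Open Scope nat_scope.

(** Write [krank n] for the rank of the complete graph on [n] vertices.
    Unboundedness forces [krank] to be strictly increasing, so an edge from [V(G)]
    to a new vertex is always a bridge of the matroid.

    Whitney implies Lovász-Yemini: if [G] is highly connected but not rigid,
    some edge [e] on [V(G)] is a bridge of [G + e]. Trading [e] for an edge [f] to
    a new vertex is then a matroid isomorphism from [G + e] to [G + f], and these
    graphs do not have the same number of vertices.

    Lovász-Yemini implies Whitney: complete graphs minus an edge are rigid, hence
    [krank] is eventually linear of some slope [d > 0], and attaching a vertex
    of degree [k] to any graph raises the rank by at least [min k d]. Let [G] be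
    highly connected and [M(G) = M(H)]. A small vertex cut of [H] splits
    the edges of [G] into [A] and [B] with [r A + r B <= r G + C]. Removing
    from [G] a vertex that meets both [A] and [B] lowers [r A + r B] by at least
    [d + 1], but [r G] by only [d]; so few vertices are mixed, and connectivity of [G]
    puts [A] or [B] inside that small set of vertices, whose edges
    are irrelevant to the rank of [G]. But [A] and [B] both contain a full vertex star of
    [H], whose removal lowers the rank. Hence [H] is highly connected, so rigid, and
    [|V(H)| = |V(G)|]. The same applied to [G - v] shows that stars go to stars. *)

(** * Edges, stars, neighbourhoods and vertex deletion *)

Definition inc (x : nat) (e : edge) := (x == e.1) || (x == e.2).

Definition star (v : nat) (U : {fset nat}) : {fset edge} :=
  [fset mkedge v u | u in U].

Definition nbr (G : {fset edge}) (v : nat) : {fset nat} :=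
  [fset u in V G | mkedge v u \in G].

(** A graph is its edge set, so a vertex that loses all its edges disappears as well: [V (del G Y)]
    may be smaller than [V G] minus [Y]. *)
Definition del (G : {fset edge}) (Y : {fset nat}) : {fset edge} :=
  [fset e in G | (e.1 \notin Y) && (e.2 \notin Y)].

Lemma in_VP x G : reflect (exists2 e, e \in G & inc x e) (x \in V G).
Proof.
apply: (iffP idP).
- by rewrite inE => /orP[] /imfsetP[e /= eG ->]; exists e => //; rewrite /inc eqxx ?orbT.
- case=> e eG /orP[]/eqP->; rewrite inE; apply/orP; [left|right];
  by apply/imfsetP; exists e.
Qed.

Lemma V_sub G H : G `<=` H -> V G `<=` V H.
Proof.
move=> /fsubsetP sGH; apply/fsubsetP => x /in_VP[e /sGH eH xe].
by apply/in_VP; exists e.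
Qed.

Lemma V_U G H : V (G `|` H) = V G `|` V H.
Proof.
apply/fsetP => x; apply/idP/idP.
- case/in_VP => e /fsetUP[] eG xe; rewrite in_fsetU; apply/orP; [left|right];
  by apply/in_VP; exists e.
- rewrite inE => /orP[]; apply/fsubsetP/V_sub; [exact: fsubsetUl|exact: fsubsetUr].
Qed.

Lemma in_K W e : (e \in K W) = [&& e.1 \in W, e.2 \in W & e.1 < e.2].
Proof. by rewrite !inE /= andbA. Qed.

Lemma simple_K W : simple_graph (K W).
Proof. by move=> e; rewrite in_K => /and3P[]. Qed.

Lemma simple_sub G H : G `<=` H -> simple_graph H -> simple_graph G.
Proof. by move=> /fsubsetP s sH e /s /sH. Qed.

Lemma simple_U G H : simple_graph G -> simple_graph H -> simple_graph (G `|` H).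
Proof. by move=> sG sH e; rewrite inE => /orP[/sG|/sH]. Qed.

Lemma simple_1 (e : edge) : e.1 < e.2 -> simple_graph [fset e].
Proof. by move=> he f; rewrite inE => /eqP->. Qed.

Lemma simple_1U (e : edge) G : e.1 < e.2 -> simple_graph G -> simple_graph (e |` G).
Proof. by move=> he sG; apply: simple_U => //; apply: simple_1. Qed.

Lemma mkedgeC u v : mkedge u v = mkedge v u.
Proof. by rewrite /mkedge minnC maxnC. Qed.

Lemma inc_mkedge x u v : inc x (mkedge u v) = (x == u) || (x == v).
Proof. by rewrite /inc /mkedge /=; lia. Qed.

Lemma mkedge_lt u v : u != v -> (mkedge u v).1 < (mkedge u v).2.
Proof. by rewrite /mkedge /=; lia. Qed.

Lemma mkedge_neq G u v : simple_graph G -> mkedge u v \in G -> u != v.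
Proof. by move=> sG /sG; rewrite /mkedge /=; lia. Qed.

Lemma mkedgeE (e : edge) : e.1 < e.2 -> e = mkedge e.1 e.2.
Proof. by case: e => a b /= h; rewrite /mkedge; congr pair; lia. Qed.

Lemma inc_edge u v (e : edge) : e.1 < e.2 -> u != v -> inc u e -> inc v e -> e = mkedge u v.
Proof. by case: e => a b /=; rewrite /inc /mkedge /= => h1 h2 h3 h4; congr pair; lia. Qed.

Lemma inc_other u (e : edge) : e.1 < e.2 -> inc u e -> exists2 v, v != u & e = mkedge u v.
Proof.
move=> he /orP[]/eqP->.
- by exists e.2; [lia|exact: mkedgeE].
- by exists e.1; [lia|rewrite mkedgeC; exact: mkedgeE].
Qed.

Lemma mkedge_inj v : injective (mkedge v).
Proof. by move=> x y; rewrite /mkedge => -[]; lia. Qed.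

Lemma in_K_inc W (e : edge) :
  e.1 < e.2 -> (forall x, inc x e -> x \in W) -> e \in K W.
Proof. by move=> he h; rewrite in_K he !h // /inc eqxx ?orbT. Qed.

Lemma K_inc W (e : edge) x : e \in K W -> inc x e -> x \in W.
Proof. by rewrite in_K => /and3P[h1 h2 _] /orP[]/eqP->. Qed.

Lemma mkedge_K W u v : (mkedge u v \in K W) = [&& u != v, u \in W & v \in W].
Proof.
apply/idP/idP.
- move=> h; rewrite (mkedge_neq (@simple_K W) h) /=.
  by rewrite !(K_inc h) // inc_mkedge eqxx ?orbT.
- case/and3P=> h1 h2 h3; apply: in_K_inc; first exact: mkedge_lt.
  by move=> x; rewrite inc_mkedge => /orP[]/eqP->.
Qed.

Lemma sub_K G W : simple_graph G -> V G `<=` W -> G `<=` K W.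
Proof.
move=> sG /fsubsetP sW; apply/fsubsetP => e eG; apply: in_K_inc; first exact: sG.
by move=> x xe; apply: sW; apply/in_VP; exists e.
Qed.

Lemma V_K_sub W : V (K W) `<=` W.
Proof. by apply/fsubsetP => x /in_VP[e eK xe]; apply: K_inc eK xe. Qed.

Lemma K_sub W W' : W `<=` W' -> K W `<=` K W'.
Proof. by move=> s; apply: sub_K; [exact: simple_K|apply: fsubset_trans s; exact: V_K_sub]. Qed.

Lemma in_starP e v U : reflect (exists2 u, u \in U & e = mkedge v u) (e \in star v U).
Proof. by apply: (iffP (imfsetP _ _ _ _)). Qed.

Lemma mkedge_star v u U : (mkedge v u \in star v U) = (u \in U).
Proof.
apply/in_starP/idP => [[w wU /mkedge_inj ->]//|uU]; by exists u.
Qed.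

Lemma card_star v U : #|` star v U| = #|` U|.
Proof. by rewrite card_imfset //; exact: mkedge_inj. Qed.

Lemma simple_star v U : v \notin U -> simple_graph (star v U).
Proof.
move=> vU e /in_starP[u uU ->]; apply: mkedge_lt.
by apply: contraNneq vU => ->.
Qed.

Lemma in_V_edge G u v : mkedge u v \in G -> (u \in V G) && (v \in V G).
Proof.
by move=> h; apply/andP; split; apply/in_VP; exists (mkedge u v) => //;
  rewrite inc_mkedge eqxx ?orbT.
Qed.

Lemma in_nbr G v u : (u \in nbr G v) = (mkedge v u \in G).
Proof.
rewrite in_fset /= inE; apply/andP/idP=> [[]//|h]; split=> //.
by case/andP: (in_V_edge h).
Qed.

Lemma in_del G Y e : (e \in del G Y) = [&& e \in G, e.1 \notin Y & e.2 \notin Y].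
Proof. by rewrite !inE. Qed.

Lemma mkedge_del G Y u v :
  (mkedge u v \in del G Y) = [&& mkedge u v \in G, u \notin Y & v \notin Y].
Proof.
rewrite in_del; congr (_ && _); rewrite /mkedge /= /minn /maxn.
by case: ltnP => _ //; rewrite andbC.
Qed.

Lemma del_sub G Y : del G Y `<=` G.
Proof. by apply/fsubsetP => e; rewrite in_del => /and3P[]. Qed.

Lemma V_del_sub G Y : V (del G Y) `<=` V G `\` Y.
Proof.
apply/fsubsetP => x /in_VP[e]; rewrite in_del => /and3P[eG h1 h2] xe.
rewrite inE; apply/andP; split; last by apply/in_VP; exists e.
by case/orP: xe => /eqP->.
Qed.

Lemma V_star v U : V (star v U) `<=` v |` U.
Proof.
apply/fsubsetP => x /in_VP[e /in_starP[u uU ->]]; rewrite inc_mkedge !inE.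
by case/orP=> /eqP->; rewrite ?eqxx ?uU ?orbT.
Qed.

(** * Independence and rank in a graph matroid family *)

Section Matroid.
Variable fam : gfamily.
Hypothesis gmf : graph_matroid_family fam.
Local Notation r := (rank fam).
Local Notation ind F := (fam F F).
Local Notation sg := simple_graph.

(** The restriction axiom makes independence of [F] the same in every host graph, so [F] can serve
    as its own host in the notation [ind]. *)
Lemma fam_ind G F : sg G -> F `<=` G -> fam G F = ind F.
Proof. by case: gmf => _ [_ h] sG sF; rewrite (h G F). Qed.

Lemma ind0 : ind fset0.
Proof. by case: gmf => h _; case: (h fset0). Qed.

Lemma ind_sub A B : sg B -> A `<=` B -> ind B -> ind A.
Proof.
move=> sB sAB iB; case: gmf => h _; case: (h B sB) => _ [h2 _].
by rewrite -(fam_ind sB sAB); apply: h2 iB.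
Qed.

Lemma ind_exchange A B : sg A -> sg B -> ind A -> ind B -> #|` A| < #|` B| ->
  exists2 e, e \in B `\` A & ind (e |` A).
Proof.
move=> sA sB iA iB lt; have sU := simple_U sA sB.
case: gmf => h _; case: (h _ sU) => _ [_ h3].
have [||||e eB] := h3 A B _ _ _ _ lt.
- exact: fsubsetUl.
- exact: fsubsetUr.
- by rewrite fam_ind // fsubsetUl.
- by rewrite fam_ind // fsubsetUr.
rewrite fam_ind // => [ie|]; first by exists e.
rewrite fsubUset fsubsetUl andbT fsub1set inE; move: eB; rewrite inE => /andP[_ ->].
by rewrite orbT.
Qed.

Lemma rank_ge F I : sg F -> I `<=` F -> ind I -> #|` I| <= r F.
Proof.
move=> sF sI iI; rewrite /rank.
apply: (@leq_bigmax_seq _ _ (fam F) (fun I : {fset edge} => #|` I|) I).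
- by rewrite fpowersetE.
- by rewrite fam_ind.
Qed.

Lemma rank_basis F : sg F -> exists I, [/\ I `<=` F, ind I & #|` I| = r F].
Proof.
move=> sF; rewrite /rank big_seq_cond.
have : (fun m => exists I, [/\ I `<=` F, ind I & #|` I| = m])
   (\max_(i <- fpowerset F | (i \in fpowerset F) && fam F i) #|` i|).
  apply: (big_ind (fun m => exists I, [/\ I `<=` F, ind I & #|` I| = m])).
  - by exists fset0; split; [exact: fsub0set|exact: ind0|rewrite cardfs0].
  - move=> x y hx hy; rewrite /maxn; by case: ifP.
  - move=> I /andP[]; rewrite fpowersetE => sI iI; exists I; split=> //.
    by rewrite -(fam_ind sF sI).
by [].
Qed.

Lemma rank_mono A B : sg B -> A `<=` B -> r A <= r B.
Proof.
move=> sB sAB; have sA := simple_sub sAB sB.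
have [I [sI iI <-]] := rank_basis sA.
by apply: rank_ge => //; apply: fsubset_trans sAB.
Qed.

Lemma ind_extend F I : sg F -> I `<=` F -> ind I ->
  exists J, [/\ I `<=` J, J `<=` F, ind J & #|` J| = r F].
Proof.
move=> sF; have [n] := ubnP (r F - #|` I|); elim: n I => // n IH I hn sI iI.
have le := rank_ge sF sI iI.
have [e|ne] := eqVneq #|` I| (r F); first by exists I.
have [J [sJ iJ cJ]] := rank_basis sF.
have lt : #|` I| < #|` J| by rewrite cJ; lia.
have [e] := ind_exchange (simple_sub sI sF) (simple_sub sJ sF) iI iJ lt.
rewrite inE => /andP[eI eJ] ieI.
have [||J' [h1 h2 h3 h4]] := IH (e |` I) _ _ ieI.
- by rewrite cardfsU1 eI; lia.
- by rewrite fsubUset sI fsub1set andbT; move/fsubsetP: sJ; apply.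
- by exists J'; split=> //; apply: fsubset_trans h1; apply: fsubsetUr.
Qed.

(** Extend a basis of the intersection to a basis [J] of the union and count [J] inside [A] and
    inside [B]. Leaving [C] and [D] free avoids computing exact unions and intersections later. *)
Lemma rank_submod A B C D : sg A -> sg B -> C `<=` A `&` B -> D `<=` A `|` B ->
  r D + r C <= r A + r B.
Proof.
move=> sA sB hC hD; have sU := simple_U sA sB.
have sI : sg (A `&` B) by apply: simple_sub sA; apply: fsubsetIl.
apply: leq_trans (leq_add (rank_mono sU hD) (rank_mono sI hC)) _.
have [I [sII iI <-]] := rank_basis sI.
have sIU : I `<=` A `|` B.
  by apply: fsubset_trans sII _; apply: fsubset_trans (fsubsetIl _ _) (fsubsetUl _ _).
have [J [IJ JU iJ <-]] := ind_extend sU sIU iI.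
have sJ : sg J by apply: simple_sub sU.
have hA : #|` J `&` A| <= r A.
  apply: rank_ge => //; first exact: fsubsetIr.
  by apply: ind_sub iJ => //; apply: fsubsetIl.
have hB : #|` J `&` B| <= r B.
  apply: rank_ge => //; first exact: fsubsetIr.
  by apply: ind_sub iJ => //; apply: fsubsetIl.
have e1 : (J `&` A) `|` (J `&` B) = J by rewrite -fsetIUr; apply/fsetIidPl.
have h2 : #|` I| <= #|` (J `&` A) `&` (J `&` B)|.
  apply: fsubset_leq_card; rewrite !fsubsetI IJ /=.
  move: sII; rewrite fsubsetI => /andP[-> ->]; done.
have := cardfsUI (J `&` A) (J `&` B); rewrite e1; lia.
Qed.

Lemma rank_U_le A S : sg A -> sg S -> r (A `|` S) <= r A + #|` S|.
Proof.
move=> sA sS; have sU := simple_U sA sS.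
have := @rank_submod A S fset0 (A `|` S) sA sS (fsub0set _) (fsubset_refl _).
have : r S <= #|` S|.
  by have [I [sI _ <-]] := rank_basis sS; apply: fsubset_leq_card.
lia.
Qed.

Lemma rank_lt_ex A B : sg A -> sg B -> r A < r B ->
  exists2 e, e \in B & r A < r (e |` A).
Proof.
move=> sA sB lt; have [I [sI iI cI]] := rank_basis sA.
have [J [sJ iJ cJ]] := rank_basis sB.
rewrite -cI -cJ in lt.
have [e] := ind_exchange (simple_sub sI sA) (simple_sub sJ sB) iI iJ lt.
rewrite inE => /andP[eI eJ] ieI; have eB : e \in B by move/fsubsetP: sJ; apply.
exists e => //; rewrite -cI.
have -> : (#|` I|).+1 = #|` e |` I| by rewrite cardfsU1 eI.
apply: rank_ge => //; first by apply: simple_1U => //; apply: sB.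
exact: fsetUS.
Qed.

Lemma rank_closure A S : sg A -> sg S -> (forall e, e \in S -> r (e |` A) = r A) ->
  r (A `|` S) = r A.
Proof.
move=> sA sS h; have sU := simple_U sA sS.
apply/eqP; rewrite eqn_leq (rank_mono sU (fsubsetUl _ _)) andbT.
rewrite leqNgt; apply/negP => /(rank_lt_ex sA (simple_U sA sS))[e]; rewrite inE => /orP[eA|eS].
- by rewrite (_ : e |` A = A) ?ltnn //; apply/fsetUidPr; rewrite fsub1set.
- by rewrite h // ltnn.
Qed.

(** Monotonicity of closure, from submodularity for [B] and [A + e]. *)
Lemma rank_1_mono A B e : sg B -> e.1 < e.2 -> A `<=` B -> r (e |` A) = r A -> r (e |` B) = r B.
Proof.
move=> sB he sAB h; have seB := simple_1U he sB.
have sA := simple_sub sAB sB; have seA := simple_1U he sA.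
have := @rank_submod B (e |` A) A (e |` B) sB seA.
rewrite fsubsetI sAB fsubsetUr fsubUset fsubsetUl andbT fsub1set !inE eqxx orbT /=.
move=> /(_ isT isT); have := rank_mono seB (fsubsetUr [fset e] B); lia.
Qed.

End Matroid.

(** * Isomorphism invariance *)

Lemma imfset_sub (T T' : choiceType) (f : T -> T') (A B : {fset T}) :
  A `<=` B -> [fset f x | x in A] `<=` [fset f x | x in B].
Proof.
move=> /fsubsetP s; apply/fsubsetP => y /imfsetP[x /= xA ->].
by apply/imfsetP; exists x => //; apply: s.
Qed.

Lemma mkedge_eq a b c d : mkedge a b = mkedge c d -> (a = c /\ b = d) \/ (a = d /\ b = c).
Proof. by rewrite /mkedge => -[]; lia. Qed.

Lemma emap_mkedge phi u v : emap phi (mkedge u v) = mkedge (phi u) (phi v).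
Proof.
rewrite /emap {2 3}/mkedge /= /minn /maxn; case: ltnP => //= _; exact: mkedgeC.
Qed.

Definition swap (a b x : nat) := if x == a then b else if x == b then a else x.

Lemma swap_inj a b : injective (swap a b).
Proof. by move=> x y; rewrite /swap; do !case: eqP; lia. Qed.

Lemma swap_id a b x : x != a -> x != b -> swap a b x = x.
Proof. by rewrite /swap; do !case: eqP; lia. Qed.

Lemma swap_l a b : swap a b a = b.
Proof. by rewrite /swap eqxx. Qed.

Lemma swapK a b : involutive (swap a b).
Proof. by move=> x; rewrite /swap; do !case: eqP; lia. Qed.

Lemma swap_fset a b (W : {fset nat}) : a \in W -> b \in W -> [fset swap a b x | x in W] = W.
Proof.
move=> aW bW; have h x : x \in W -> swap a b x \in W by rewrite /swap; case: eqP => // _; case: eqP.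
apply/fsetP => x; apply/imfsetP/idP => [[y /= yW ->]|xW]; first exact: h.
by exists (swap a b x); [exact: h|rewrite swapK].
Qed.

Lemma emap_K phi W : {in W &, injective phi} ->
  [fset emap phi e | e in K W] = K [fset phi x | x in W].
Proof.
move=> inj; apply/fsetP => f; apply/imfsetP/idP => [[e /= eK ->]|fK].
- have e12 := simple_K eK; move: eK; rewrite in_K => /and3P[h1 h2 _].
  rewrite /emap mkedge_K !in_imfset // !andbT.
  by apply: contraTneq e12 => /inj -> //; rewrite ltnn.
- have f12 := simple_K fK; move: fK; rewrite in_K => /and3P[/imfsetP[x /= xW h1] /imfsetP[y /= yW h2] _].
  exists (mkedge x y); last by rewrite emap_mkedge -h1 -h2; apply: mkedgeE.
  rewrite /= mkedge_K xW yW !andbT; apply: contraTneq f12 => exy.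
  by rewrite h1 h2 exy ltnn.
Qed.

Lemma exists_fresh (W : {fset nat}) : exists w, w \notin W.
Proof.
exists (\max_(x <- W) x).+1; apply/negP => h.
by have := @leq_bigmax_seq _ _ xpredT id _ h isT; rewrite /= ltnn.
Qed.

Lemma fset_extend (W : {fset nat}) n : #|` W| <= n ->
  exists2 W', W `<=` W' & #|` W'| = n.
Proof.
move=> h; have -> : n = #|` W| + (n - #|` W|) by lia.
elim: (n - #|` W|) => [|m [W' s cW]]; first by exists W; rewrite ?addn0.
have [w wW] := exists_fresh W'; exists (w |` W').
- by apply: fsubset_trans s _; apply: fsubsetUr.
- by rewrite cardfsU1 wW cW addnS.
Qed.

Lemma fset_shrink (T : choiceType) (W : {fset T}) n : n <= #|` W| ->
  exists2 W', W' `<=` W & #|` W'| = n.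
Proof.
elim: n => [|n IH] h; first by exists fset0; rewrite ?fsub0set ?cardfs0.
have [|W' s cW] := IH; first lia.
have : W `\` W' != fset0.
  by rewrite fsetD_eq0; apply: contraL h => /fsubset_leq_card; rewrite cW; lia.
case/fset0Pn => x; rewrite inE => /andP[xW' xW]; exists (x |` W').
- by rewrite fsubUset fsub1set xW.
- by rewrite cardfsU1 xW' cW.
Qed.

Lemma exists_fset_card n : exists W : {fset nat}, #|` W| = n.
Proof. by have [|W _ h] := @fset_extend fset0 n; [rewrite cardfs0|exists W]. Qed.

Section Isomorphism.
Variable fam : gfamily.
Hypothesis gmf : graph_matroid_family fam.
Local Notation r := (rank fam).
Local Notation ind F := (fam F F).
Local Notation sg := simple_graph.

Lemma matroid_iso_rank G H psi : sg G -> sg H -> matroid_iso fam G H psi -> r G = r H.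
Proof.
move=> sG sH [inj [im hind]].
have cpsi F : F `<=` G -> #|` [fset psi e | e in F]| = #|` F|.
  move=> /fsubsetP s; apply: card_in_imfset => x y /= xF yF; apply: inj; exact: s.
have spsi F : F `<=` G -> [fset psi e | e in F] `<=` H.
  by move=> s; rewrite -im; apply: imfset_sub.
apply/eqP; rewrite eqn_leq; apply/andP; split.
- have [I [sI iI <-]] := rank_basis gmf sG; rewrite -cpsi //.
  apply: (rank_ge gmf) => //; first exact: spsi.
  by rewrite -(fam_ind gmf sH) ?spsi // -hind // (fam_ind gmf sG).
- have [J [sJ iJ <-]] := rank_basis gmf sH.
  pose I := [fset e in G | psi e \in J].
  have sI : I `<=` G by apply: fset_sub.
  have eJ : J = [fset psi e | e in I].
    apply/fsetP => f; apply/idP/imfsetP => [fJ|[e /=]].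
    - have : f \in H by move/fsubsetP: sJ; apply.
      by rewrite -im => /imfsetP[e /= eG ef]; exists e; rewrite // !inE /= eG -ef.
    - by rewrite !inE /= => /andP[_ h] ->.
  rewrite eJ cpsi //; apply: (rank_ge gmf) => //.
  by rewrite -(fam_ind gmf sG) // hind // -eJ (fam_ind gmf sH).
Qed.

Lemma matroid_iso_sub G H psi F : sg G -> sg H -> matroid_iso fam G H psi -> F `<=` G ->
  matroid_iso fam F [fset psi e | e in F] psi.
Proof.
move=> sG sH [inj [im hind]] sF.
have spsi A : A `<=` G -> [fset psi e | e in A] `<=` H.
  by move=> s; rewrite -im; apply: imfset_sub.
have sFG := fsubsetP sF.
split; first by move=> x y xF yF; apply: inj; apply: sFG.
split=> // A sA; have sAG := fsubset_trans sA sF.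
rewrite (fam_ind gmf (simple_sub sF sG)) // (fam_ind gmf (simple_sub (spsi _ sF) sH)).
- by rewrite -(fam_ind gmf sG) // hind // (fam_ind gmf sH) // spsi.
- exact: imfset_sub.
Qed.

Lemma matroid_iso_rank_sub G H psi F : sg G -> sg H -> matroid_iso fam G H psi -> F `<=` G ->
  r F = r [fset psi e | e in F].
Proof.
move=> sG sH iso sF; have [inj [im _]] := iso.
apply: (matroid_iso_rank (psi := psi)).
- exact: (simple_sub sF sG).
- by apply: (simple_sub _ sH); rewrite -im; apply: imfset_sub.
- exact: (matroid_iso_sub sG sH iso sF).
Qed.

Lemma rank_emap F phi : sg F -> {in V F &, injective phi} -> r [fset emap phi e | e in F] = r F.
Proof.
move=> sF inj; set H := [fset emap phi e | e in F].
have VF e : e \in F -> (e.1 \in V F) /\ (e.2 \in V F).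
  by move=> eF; split; apply/in_VP; exists e; rewrite // /inc eqxx ?orbT.
have sH : sg H.
  move=> f /imfsetP[e /= eF ->]; have [h1 h2] := VF _ eF; apply: mkedge_lt.
  by have := sF _ eF; apply: contraTneq => /inj -> //; rewrite ltnn.
have einj u v e : u \in V F -> v \in V F -> e \in F ->
    mkedge (phi u) (phi v) = emap phi e -> mkedge u v = e.
  move=> uV vV eF; have [h1 h2] := VF _ eF; rewrite (mkedgeE (sF _ eF)) emap_mkedge.
  case/mkedge_eq => -[e1 e2]; rewrite (inj _ _ uV _ e1) // (inj _ _ vV _ e2) //.
  exact: mkedgeC.
have giso : graph_iso F H phi.
  split=> //; split.
  - apply/fsetP => y; apply/imfsetP/in_VP => [[x /= /in_VP[e eF xe] ->]|[f /imfsetP[e /= eF ->]]].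
    + exists (emap phi e); first by apply/imfsetP; exists e.
      by rewrite inc_mkedge; case/orP: xe => /eqP->; rewrite eqxx ?orbT.
    + have [h1 h2] := VF _ eF.
      by rewrite inc_mkedge => /orP[]/eqP->; [exists e.1|exists e.2].
  - move=> u v uV vV; apply/idP/imfsetP => [h|[e /= eF]].
    + by exists (mkedge u v); rewrite ?emap_mkedge.
    + by move/einj => ->.
symmetry; apply: (matroid_iso_rank (psi := emap phi)) => //; split; last first.
  split=> // A sA; case: gmf => _ [h _]; exact: h giso _ sA.
move=> e f eF fF; have [h1 h2] := VF _ eF.
by rewrite {1}(mkedgeE (sF _ eF)) emap_mkedge => /einj <- //; apply: mkedgeE; apply: sF.
Qed.

Lemma rank_K W W' : #|` W| = #|` W'| -> r (K W) = r (K W').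
Proof.
(* Vertices are matched by their positions in the two enumerations. *)
move=> h; pose phi x := nth 0 W' (index x W).
have sz x : x \in W -> index x W < size W' by move=> xW; rewrite -h index_mem.
have inj : {in W &, injective phi}.
  move=> x y xW yW /eqP; rewrite nth_uniq ?sz ?fset_uniq // => /eqP e.
  by rewrite -(nth_index 0 xW) e nth_index.
have e : [fset phi x | x in W] = W'.
  apply/eqP; rewrite eqEfcard card_in_imfset //= h leqnn andbT.
  by apply/fsubsetP => y /imfsetP[x /= xW ->]; apply: mem_nth; apply: sz.
rewrite -e -emap_K // rank_emap //; first exact: simple_K.
by move=> x y /(fsubsetP (V_K_sub W)) xW /(fsubsetP (V_K_sub W)) yW; apply: inj.
Qed.

(** * Ranks of complete graphs *)

Definition krank n := r (K [fset i | i in iota 0 n]).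

Lemma krankE W : r (K W) = krank #|` W|.
Proof.
apply: rank_K; rewrite card_imfset //=.
by rewrite undup_id ?iota_uniq // size_iota.
Qed.

Lemma krank_mono m n : m <= n -> krank m <= krank n.
Proof.
move=> h; have [W cW] := exists_fset_card m.
have [|W' s cW'] := @fset_extend W n; first by rewrite cW.
rewrite -cW -cW' -!krankE; apply: (rank_mono gmf); [exact: simple_K|exact: K_sub].
Qed.

(** The transposition of [v] and [v'] preserves [F] and carries one edge to the other. *)
Lemma rank_edge_swap F v v' w : sg F -> v != w -> v' != w ->
  [fset emap (swap v v') e | e in F] = F ->
  r (mkedge v w |` F) = r F -> r (mkedge v' w |` F) = r F.
Proof.
move=> sF vw v'w im h.
rewrite -h -(@rank_emap (mkedge v w |` F) (swap v v')).
- congr r; rewrite -{1}im; apply/fsetP => e.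
  rewrite in_fset1U; apply/orP/imfsetP => [[/eqP->|/imfsetP[f /= fF ->]]|[f /=]].
  + exists (mkedge v w); first by rewrite /= fset1U1.
    by rewrite emap_mkedge swap_l swap_id // eq_sym.
  + by exists f => //=; rewrite in_fset1U fF orbT.
  + rewrite in_fset1U => /orP[/eqP->|fF] ->.
    * by rewrite emap_mkedge swap_l swap_id 1?eq_sym // eqxx; left.
    * by right; apply/imfsetP; exists f.
- by apply: simple_1U => //; apply: mkedge_lt.
- by move=> x y _ _; apply: swap_inj.
Qed.

Lemma K_1U_edge W b e : e \in K (b |` W) -> e \notin K W -> b \notin W ->
  exists2 v, v \in W & e = mkedge v b.
Proof.
move=> eK neK bW; have e12 := simple_K eK; have := K_inc eK => h.
have [ib|ib] := boolP (inc b e).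
- have [v vb ee] := inc_other e12 ib; exists v; last by rewrite mkedgeC.
  by have := h v; rewrite ee inc_mkedge eqxx orbT !inE (negbTE vb) => /(_ isT).
- case/negP: neK; apply: in_K_inc => // x xe; have := h x xe; rewrite in_fset1U.
  by case/orP => // /eqP exb; rewrite -exb xe in ib.
Qed.

(** An edge from an old vertex [v] to a new vertex [b] lies in the complete graph on [b] and [n] old
    vertices including [v]. By hypothesis that graph is spanned by its old part. Here [0 < n] makes
    room for [v]. *)
Lemma krank_stable_step n : 0 < n -> krank n.+1 = krank n -> krank n.+2 = krank n.+1.
Proof.
move=> n0 h; have [W cW] := exists_fset_card n.+1.
have [b bW] := exists_fresh W.
have cb : #|` b |` W| = n.+2 by rewrite cardfsU1 bW cW.
rewrite -cb -cW -!krankE.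
have sK := @simple_K W; have sKb := @simple_K (b |` W).
have -> : K (b |` W) = K W `|` K (b |` W).
  by symmetry; apply/fsetUidPr; apply: K_sub; apply: fsubsetUr.
apply: (rank_closure gmf) => // e eK.
have [eW|neW] := boolP (e \in K W).
  by congr r; apply/fsetUidPr; rewrite fsub1set.
have [v vW ee] := K_1U_edge eK neW bW.
have [|W0 s0 c0] := @fset_shrink _ (W `\ v) n.-1.
  by have := cardfsD1 v W; rewrite vW cW; lia.
have vW0 : v \notin W0 by apply/negP => /(fsubsetP s0); rewrite !inE eqxx.
have s1 : v |` W0 `<=` W.
  by rewrite fsubUset fsub1set vW; apply: fsubset_trans s0 _; apply: fsubsetDl.
have bv : b \notin v |` W0 by apply: contra bW => /(fsubsetP s1).
have c1 : #|` v |` W0| = n by rewrite cardfsU1 vW0 c0; lia.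
have e12 := simple_K eK.
apply: (@rank_1_mono _ gmf (K (v |` W0))) => //; first exact: K_sub.
apply/eqP; rewrite eqn_leq; apply/andP; split; last first.
  by apply: (rank_mono gmf); [exact: (simple_1U e12 (@simple_K _))|apply: fsubsetUr].
rewrite krankE c1 -h.
have <- : #|` b |` (v |` W0)| = n.+1 by rewrite cardfsU1 bv c1.
rewrite -krankE; apply: (rank_mono gmf); first exact: simple_K.
rewrite fsubUset fsub1set K_sub ?fsubsetUr // andbT ee mkedge_K !inE !eqxx ?orbT /= andbT.
by apply: contraNneq bv => <-; rewrite !inE eqxx.
Qed.

Hypothesis unb : unbounded fam.

(** Two equal consecutive values would make [krank] constant from there on. Index 0 is excluded
    because complete graphs on 0 and 1 vertices are both edgeless. *)
Lemma krank_lt n : 0 < n -> krank n < krank n.+1.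
Proof.
move=> n0; rewrite ltnNge; apply/negP => le.
have e : krank n.+1 = krank n by apply/eqP; rewrite eqn_leq le krank_mono.
have st m : krank (n + m).+1 = krank (n + m).
  by elim: m => [|m IH]; rewrite ?addn0 // addnS; apply: krank_stable_step => //; lia.
have all m : krank (n + m) = krank n.
  by elim: m => [|m IH]; rewrite ?addn0 // addnS st.
have [m] := unb (krank n); rewrite -/(krank m) => lt.
by have := krank_mono (leq_addl n m); rewrite all; lia.
Qed.

Lemma krank_ltn m n : 0 < m -> m < n -> krank m < krank n.
Proof.
move=> m0 h; apply: leq_trans (krank_lt m0) _; exact: krank_mono.
Qed.

(** If [K W] spanned one edge from [W] to [w], by symmetry it would span all of them, and adding [w]
    would not raise the rank of the complete graph. *)
Lemma rank_K_pendant W v w : v \in W -> w \notin W -> r (K W) < r (mkedge v w |` K W).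
Proof.
move=> vW wW; have sK := @simple_K W.
have vw : v != w by apply: contraNneq wW => <-.
rewrite ltn_neqAle; apply/andP; split; last first.
  by apply: (rank_mono gmf); [apply: simple_1U => //; apply: mkedge_lt|apply: fsubsetUr].
apply/eqP => h.
suff : r (K (w |` W)) = r (K W).
  have cw : #|` w |` W| = (#|` W|).+1 by rewrite cardfsU1 wW.
  have : 0 < #|` W| by rewrite cardfs_gt0; apply/fset0Pn; exists v.
  by rewrite !krankE cw => /krank_lt; lia.
have -> : K (w |` W) = K W `|` K (w |` W).
  by symmetry; apply/fsetUidPr; apply: K_sub; apply: fsubsetUr.
apply: (rank_closure gmf) => // [|e eK]; first exact: simple_K.
have [eW|neW] := boolP (e \in K W).
  by congr r; apply/fsetUidPr; rewrite fsub1set.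
have [u uW ->] := K_1U_edge eK neW wW.
apply: (@rank_edge_swap _ v) => //; first by apply: contraNneq wW => <-.
by rewrite emap_K ?swap_fset // => x y _ _; apply: swap_inj.
Qed.

Lemma rank_pendant G v w : sg G -> v \in V G -> w \notin V G -> r G < r (mkedge v w |` G).
Proof.
move=> sG vG wG; have vw : v != w by apply: contraNneq wG => <-.
have seG : sg (mkedge v w |` G) by apply: simple_1U => //; apply: mkedge_lt.
rewrite ltn_neqAle (rank_mono gmf seG (fsubsetUr _ _)) andbT; apply/eqP => h.
have := rank_K_pendant vG wG.
have e : r (mkedge v w |` K (V G)) = r (K (V G)).
  apply: (@rank_1_mono _ gmf G); [exact: simple_K|exact: mkedge_lt| |by rewrite -h].
  exact: sub_K.
by rewrite e ltnn.
Qed.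

(** Adding [e] raises the rank of [F] too, so for independent [F] a basis of [F + e] has to be the
    whole set. *)
Lemma ind_bridge G (e : edge) (F : {fset edge}) : sg G -> e.1 < e.2 -> r G < r (e |` G) -> F `<=` G ->
  ind (e |` F) = ind F.
Proof.
move=> sG e12 lt sF.
have sF' := simple_sub sF sG; have seF := simple_1U e12 sF'.
apply/idP/idP => [|iF]; first by apply: (ind_sub gmf) => //; apply: fsubsetUr.
have ltF : r F < r (e |` F).
  rewrite ltn_neqAle (rank_mono gmf seF (fsubsetUr _ _)) andbT; apply/eqP => h.
  by have := rank_1_mono gmf sG e12 sF (esym h); lia.
have [I [sI iI cI]] := rank_basis gmf seF.
have le := rank_ge gmf sF' (fsubset_refl _) iF.
suff -> : e |` F = I by [].
apply/eqP; rewrite eq_sym eqEfcard sI cI cardfsU1 /=.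
by apply: leq_trans ltF; rewrite -add1n leq_add ?leq_b1.
Qed.

(** * The Whitney property implies the Lovász-Yemini property *)

Lemma whitney_lovasz_yemini : whitney_property fam -> lovasz_yemini_property fam.
Proof.
case=> c hW; exists c => G sG [cG kG]; apply/eqP.
have sGK : G `<=` K (V G) by apply: sub_K.
rewrite eqn_leq (rank_mono gmf (@simple_K _) sGK) /= leqNgt; apply/negP => lt.
have [e eK lte] := rank_lt_ex gmf sG (@simple_K _) lt.
have e12 := simple_K eK.
have [w wG] := exists_fresh (V G).
have /fset0Pn[v vG] : V G != fset0 by rewrite -cardfs_gt0; lia.
have vw : v != w by apply: contraNneq wG => <-.
set f := mkedge v w; have f12 : f.1 < f.2 by apply: mkedge_lt.
have ltf : r G < r (f |` G) by apply: rank_pendant.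
have neG : e \notin G.
  by apply: contraTN lte => eG; rewrite -leqNgt (_ : e |` G = G) //; apply/fsetUidPr; rewrite fsub1set.
have nfG : f \notin G.
  by apply: contra wG => /in_V_edge/andP[].
have VeG : V (e |` G) = V G.
  rewrite V_U; apply/fsetUidPr; apply/fsubsetP => x /in_VP[g]; rewrite inE => /eqP->.
  exact: K_inc.
have seG := simple_1U e12 sG; have sfG := simple_1U f12 sG.
(* The ends of [e] lie in [V G], so adding [e] keeps the vertex set and all crossing edges. *)
have kc : k_connected c (e |` G).
  split; rewrite VeG // => X sX cX S sS S0 SW.
  have [u [u' [h1 h2 h3]]] := kG X sX cX S sS S0 SW.
  by exists u, u'; split=> //; rewrite in_fset1U h3 orbT.
(* [psi] fixes [G] and trades [e] for [f]. Both are bridges, so on either side independence depends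
   only on the part inside [G]. *)
pose psi x := if x == e then f else x.
have psiG F : F `<=` G -> [fset psi x | x in F] = F.
  move=> /fsubsetP sF; have h x : x \in F -> psi x = x.
    by move=> xF; rewrite /psi; case: eqP => // ex; move: neG; rewrite -ex sF.
  apply/fsetP => x; apply/imfsetP/idP => [[y /= yF ->]|xF]; first by rewrite h.
  by exists x; rewrite ?h.
have psie F : F `<=` G -> [fset psi x | x in e |` F] = f |` F.
  move=> sF; rewrite -[in RHS](psiG _ sF); apply/fsetP => x; apply/imfsetP/idP => [[y /=]|].
  - rewrite in_fset1U => /orP[/eqP-> ->|yF ->]; first by rewrite /psi eqxx fset1U1.
    by rewrite in_fset1U in_imfset ?orbT.
  - rewrite in_fset1U => /orP[/eqP->|/imfsetP[y /= yF ->]].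
    + by exists e; rewrite /= ?fset1U1 // /psi eqxx.
    + by exists y; rewrite //= in_fset1U yF orbT.
have iso : matroid_iso fam (e |` G) (f |` G) psi.
  split; last split; last 1 first.
  - move=> F sF; have [eF|neF] := boolP (e \in F).
    + have eF1 := fsetD1K eF; set F0 := F `\ e in eF1.
      have sF0 : F0 `<=` G.
        apply/fsubsetP => x; rewrite !inE => /andP[ne /(fsubsetP sF)].
        by rewrite in_fset1U (negbTE ne).
      rewrite -eF1 psie // !(fam_ind gmf) // ?fsetUS //.
      by rewrite !(ind_bridge sG).
    + have sF0 : F `<=` G.
        apply/fsubsetP => x xF; have := fsubsetP sF _ xF; rewrite in_fset1U.
        by case/orP => // /eqP ex; rewrite -ex xF in neF.
      by rewrite psiG // !(fam_ind gmf) // fsubsetU // sF0 orbT.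
  - move=> x y; rewrite !in_fset1U /psi => hx hy.
    case: eqP => [ex|/eqP nx]; case: eqP => [ey|/eqP ny] h //; first by rewrite ex ey.
    + by move: hy nfG; rewrite (negbTE ny) -h /= => ->.
    + by move: hx nfG; rewrite (negbTE nx) h /= => ->.
  - exact: psie.
have [phi [[_ [im _]] _]] := hW _ seG kc _ _ sfG iso.
have wH : w \in V (f |` G).
  by apply/in_VP; exists f; rewrite ?fset1U1 // inc_mkedge eqxx orbT.
(* Reconstructibility would map the vertices of [G] onto a set that contains them all and also
   [w]. *)
have : w |` V G `<=` V (f |` G) by rewrite fsubUset fsub1set wH V_sub ?fsubsetUr.
move/fsubset_leq_card; rewrite -im cardfsU1 wG VeG add1n ltnNge => /negP; apply.
exact: leq_imfset_card.
Qed.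

End Isomorphism.

(** * Connectivity *)

Lemma k_connected_le k k' G : k <= k' -> k_connected k' G -> k_connected k G.
Proof.
move=> le [h1 h2]; split=> [|X sX cX]; first lia.
by apply: h2 => //; lia.
Qed.

Lemma notin_nbr G x : simple_graph G -> x \notin nbr G x.
Proof. by move=> sG; rewrite in_nbr; apply/negP => /(mkedge_neq sG); rewrite eqxx. Qed.

Lemma nbr_sub G x : nbr G x `<=` V G.
Proof. by apply/fsubsetP => y; rewrite in_nbr => /in_V_edge/andP[]. Qed.

Lemma nbr_neq0 G x : simple_graph G -> x \in V G -> nbr G x != fset0.
Proof.
move=> sG /in_VP[e eG xe]; have [y _ ee] := inc_other (sG _ eG) xe.
by apply/fset0Pn; exists y; rewrite in_nbr -ee.
Qed.

Lemma fset_neq1 (T : choiceType) (W : {fset T}) x : 1 < #|` W| -> [fset x] != W.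
Proof. by move=> h; apply: contraTneq h => <-; rewrite cardfs1. Qed.

(** Deleting fewer than [k] neighbours would isolate [x], while more than [k] vertices in [G] leave
    something besides [x]. *)
Lemma k_connected_nbr k G x : simple_graph G -> k_connected k G -> x \in V G ->
  k <= #|` nbr G x|.
Proof.
move=> sG [h1 h2] xG; rewrite leqNgt; apply/negP => lt.
have cD : #|` V G `\` nbr G x| = #|` V G| - #|` nbr G x|.
  by rewrite cardfsD (fsetIidPr (nbr_sub _ _)).
have [|||u [v []]] := h2 _ (nbr_sub G x) lt [fset x].
- by rewrite fsub1set inE xG notin_nbr.
- by apply/fset0Pn; exists x; rewrite inE.
- by apply: fset_neq1; rewrite cD; lia.
- by rewrite !in_fsetD => /fset1P -> /andP[_ /andP[+ _]] h; rewrite in_nbr h.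
Qed.

Lemma k_connected_nbrD k G Y x : simple_graph G -> k_connected (k + #|` Y|) G -> x \in V G ->
  k <= #|` nbr G x `\` Y|.
Proof.
move=> sG kG xG; have := k_connected_nbr sG kG xG.
have := fsubset_leq_card (fsubsetIr (nbr G x) Y).
have := cardfsID Y (nbr G x); lia.
Qed.

(** As [0 < k], each vertex outside [Y] keeps a neighbour, so only [Y] is lost. A cut [X] of the
    rest becomes the cut [Y] with [X] in [G]. *)
Lemma k_connected_del k G Y : simple_graph G -> 0 < k -> Y `<=` V G ->
  k_connected (k + #|` Y|) G -> V (del G Y) = V G `\` Y /\ k_connected k (del G Y).
Proof.
move=> sG k0 sY kG.
have eV : V (del G Y) = V G `\` Y.
  apply/eqP; rewrite eqEfsubset V_del_sub /=; apply/fsubsetP => x; rewrite inE => /andP[xY xG].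
  have := k_connected_nbrD sG kG xG => h.
  have /fset0Pn[y] : nbr G x `\` Y != fset0 by rewrite -cardfs_gt0; lia.
  rewrite inE in_nbr => /andP[yY xy]; apply/in_VP; exists (mkedge x y).
    by rewrite mkedge_del xy xY.
  by rewrite inc_mkedge eqxx.
case: kG => h1 h2; split=> //; split; rewrite eV.
- by rewrite cardfsD (fsetIidPr sY); lia.
- move=> X sX cX S sS S0 SW.
  have sXV : X `<=` V G by apply: fsubset_trans sX (fsubsetDl _ _).
  have [|||||u [v [uS vS uv]]] := h2 (Y `|` X) _ _ S.
  + by rewrite fsubUset sY.
  + by have := cardfsUI Y X; lia.
  + by rewrite -fsetDDl.
  + exact: S0.
  + by rewrite -fsetDDl.
  exists u, v; split=> //; first by rewrite (fsetDDl (V G)).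
  rewrite mkedge_del uv; have := fsubsetP sS _ uS; rewrite !in_fsetD => /and3P[_ -> _].
  by move: vS; rewrite !inE; case: (v \in Y) => //; rewrite andbF.
Qed.

Lemma K_minus_edge_connected k W a b : k + 4 <= #|` W| ->
  V (K W `\ mkedge a b) = W /\ k_connected k (K W `\ mkedge a b).
Proof.
move=> cW.
(* Such a [w] is adjacent to every other vertex, so it links any remaining vertex set to its
   complement. The [k + 4] vertices outnumber [X] together with [a] and [b]. *)
have third X : #|` X| <= k.+1 -> exists w, [/\ w \in W, w \notin X, w != a & w != b].
  move=> cX; have /fset0Pn[w] : W `\` (X `|` [fset a; b]) != fset0.
    rewrite fsetD_eq0; apply: contraL cW => /fsubset_leq_card.
    have := cardfsUI X [fset a; b]; have := cardfs2 a b; case: (a != b); lia.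
  by rewrite !inE => /andP[]; rewrite !negb_or => /and3P[h1 h2 h3] h4; exists w.
have ok x w : x \in W -> w \in W -> x != w -> w != a -> w != b -> mkedge x w \in K W `\ mkedge a b.
  move=> xW wW xw wa wb; rewrite in_fsetD1 mkedge_K xW wW xw !andbT.
  by apply/eqP => /mkedge_eq; lia.
have eV : V (K W `\ mkedge a b) = W.
  apply/eqP; rewrite eqEfsubset; apply/andP; split.
    by apply: fsubset_trans (V_K_sub W); apply: V_sub; apply: fsubsetDl.
  apply/fsubsetP => x xW; have [|w [wW wx wa wb]] := third [fset x]; first by rewrite cardfs1.
  apply/in_VP; exists (mkedge x w); last by rewrite inc_mkedge eqxx.
  by apply: ok => //; rewrite eq_sym -in_fset1.
split=> //; split; rewrite eV; first lia.
move=> X sX cX S sS S0 SW; have [|w [wW wX wa wb]] := third X; first lia.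
have [wS|wS] := boolP (w \in S).
- have /fset0Pn[v] : (W `\` X) `\` S != fset0.
    by apply: contraNneq SW => /eqP; rewrite fsetD_eq0 eqEfsubset sS => ->.
  move=> vD; exists w, v; split=> //; rewrite mkedgeC; apply: ok => //.
    by move: vD; rewrite !in_fsetD => /and3P[].
  by apply: contraTneq vD => ->; rewrite !in_fsetD wS.
- case/fset0Pn: S0 => u uS; exists u, w; split=> //; first by rewrite !in_fsetD wS wX.
  apply: ok => //; last by apply: contraNneq wS => <-.
  by have := fsubsetP sS _ uS; rewrite in_fsetD => /andP[].
Qed.

(** * Independent selections in digraphs of outdegree two *)

Lemma sum_nat_pred (T : Type) (p : pred T) (s : seq T) :
  \sum_(i <- s) (p i : nat) = count p s.
Proof. by elim: s => [|x s IH]; rewrite ?big_nil // big_cons IH. Qed.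

(* The arcs x -> a x and x -> b x contribute average indegree at most 2,
   so the digraph is 4-degenerate and greedy selection works. *)
Lemma outdegree2_indep_seq (a b : nat -> nat) k (s : seq nat) :
  uniq s -> (forall z, z \in s -> a z != z /\ b z != z) -> 5 * k <= size s ->
  exists t, [/\ uniq t, {subset t <= s}, size t = k &
    forall y, y \in t -> a y \notin t /\ b y \notin t].
Proof.
elim: k s => [|k IH] s us hab hs; first by exists [::].
(* Indegrees under one function sum to at most [size s], each [u] having a single image. *)
have sumle f : \sum_(z <- s) count (fun u => f u == z) s <= size s.
  under eq_bigr do rewrite -sum_nat_pred.
  rewrite exchange_big /= -sum1_size; apply: leq_sum => u _.
  rewrite (eq_bigr (fun z => nat_of_bool (pred1 (f u) z))) => [|z _]; last by rewrite /= eq_sym.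
  by rewrite sum_nat_pred count_uniq_mem //; apply: leq_b1.
(* By averaging, some vertex has at most two incoming arcs. *)
have [z zs hz] : exists2 z, z \in s &
    count (fun u => a u == z) s + count (fun u => b u == z) s <= 2.
  apply/hasP; apply/negPn/negP => /hasPn h.
  have : \sum_(z <- s) 3 <=
      \sum_(z <- s) (count (fun u => a u == z) s + count (fun u => b u == z) s).
    by rewrite big_seq [leqRHS]big_seq; apply: leq_sum => z /h; rewrite -ltnNge.
  rewrite big_split /= big_const_seq count_predT iter_addn addn0.
  by have := sumle a; have := sumle b; lia.
(* Discard [z], its two out-neighbours and its at most two in-neighbours: five losses per chosen
   vertex, hence the factor 5. *)
pose p u := [&& u != z, u != a z, u != b z, a u != z & b u != z].
have cnt t : size t <= count p t + (count_mem z t + count_mem (a z) t + count_mem (b z) t) +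
   (count (fun u => a u == z) t + count (fun u => b u == z) t).
  elim: t => //= u t; rewrite /p.
  by case: (u == z); case: (u == a z); case: (u == b z); case: (a u == z); case: (b u == z) => /=; lia.
have [|v||t [ut st ct ht]] := IH (filter p s).
- exact: filter_uniq.
- by rewrite mem_filter => /andP[_ /hab].
- have c1 w : count_mem w s <= 1 by rewrite count_uniq_mem //; apply: leq_b1.
  rewrite size_filter; move: (cnt s) (c1 z) (c1 (a z)) (c1 (b z)) hs hz.
  set n1 := count p s; set n2 := count_mem z s; set n3 := count_mem (a z) s.
  set n4 := count_mem (b z) s; set n5 := count _ s; set n6 := count _ s.
  set n0 := size s; lia.
have ht' y : y \in t -> p y /\ y \in s.
  by move=> /st; rewrite mem_filter => /andP[].
exists (z :: t); split=> /=.
- rewrite ut andbT; apply/negP => /ht'[]; by rewrite /p eqxx.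
- by move=> y; rewrite inE => /orP[/eqP->//|/ht'[]].
- by rewrite ct.
- move=> y; rewrite !inE => /orP[/eqP->|yt].
  + have [/negbTE-> /negbTE->] := hab z zs; split=> /=; apply/negP => /ht'[/and5P[]];
    by rewrite eqxx.
  + have [/and5P[_ _ _ /negbTE-> /negbTE->] _] := ht' y yt; exact: ht.
Qed.

Lemma outdegree2_indep (a b : nat -> nat) k (Z : {fset nat}) :
  (forall z, z \in Z -> a z != z /\ b z != z) -> 5 * k <= #|` Z| ->
  exists Y, [/\ Y `<=` Z, #|` Y| = k & forall y, y \in Y -> a y \notin Y /\ b y \notin Y].
Proof.
move=> hab hk; have [t [ut st ct ht]] := outdegree2_indep_seq (fset_uniq Z) hab hk.
exists [fset y in t]; split.
- by apply/fsubsetP => y; rewrite in_fset /= => /st.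
- by rewrite card_imfset //= undup_id.
- by move=> y; rewrite !in_fset /= => /ht[].
Qed.

(** * Rank growth at a new vertex *)

Lemma nonincreasing_eventually_const (u : nat -> nat) N :
  (forall n, N <= n -> u n.+1 <= u n) -> exists2 n0, N <= n0 & forall n, n0 <= n -> u n = u n0.
Proof.
have [m] := ubnP (u N); elim: m N => // m IH N lt mono.
have [[n le ltn]|no] := classic (exists2 n, N <= n & u n < u N).
  have [||n0 h1 h2] := IH n; first lia.
  - by move=> k hk; apply: mono; lia.
  - by exists n0 => //; lia.
exists N => // n le; apply/eqP; rewrite eqn_leq; apply/andP; split; last first.
  by rewrite leqNgt; apply/negP => h; apply: no; exists n.
have -> : n = N + (n - N) by lia.
elim: (n - N) => [|k IHk]; first by rewrite addn0.
by rewrite addnS; apply: leq_trans IHk; apply: mono; lia.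
Qed.

Section Growth.
Variable fam : gfamily.
Hypothesis gmf : graph_matroid_family fam.
Hypothesis unb : unbounded fam.
Local Notation r := (rank fam).
Local Notation sg := simple_graph.
Local Notation krank := (krank fam).

(** The complete graph on [a], [b] and [W] minus the edge [ab] is the union of two complete graphs
    that share [K W]. With at least [c + 4] vertices it is rigid, so it has full rank, and
    submodularity applies. *)
Lemma krank_concave c : (forall G, sg G -> k_connected c G -> rigid fam G) ->
  forall n, c + 2 <= n -> krank n.+2 + krank n <= krank n.+1 + krank n.+1.
Proof.
move=> hLY n hn; have [W cW] := exists_fset_card n.
have [a aW] := exists_fresh W; have [b bW] := exists_fresh (a |` W).
move: (bW); rewrite in_fset1U negb_or => /andP[ba bW'].
have ca : #|` a |` W| = n.+1 by rewrite cardfsU1 aW cW.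
have cb : #|` b |` W| = n.+1 by rewrite cardfsU1 bW' cW.
have cab : #|` b |` (a |` W)| = n.+2 by rewrite cardfsU1 bW ca.
have [|eV kc] := @K_minus_edge_connected c (b |` (a |` W)) a b; first by rewrite cab; lia.
have s1 : sg (K (b |` (a |` W)) `\ mkedge a b).
  by apply: (simple_sub (fsubsetDl _ _)); apply: simple_K.
have := hLY _ s1 kc; rewrite /rigid eV (krankE gmf (b |` (a |` W))) cab => <-.
rewrite -{1}cW -{1}ca -cb -!(krankE gmf).
apply: (rank_submod gmf); [exact: simple_K|exact: simple_K| |].
- by rewrite fsubsetI !K_sub // fsubsetUr.
- apply/fsubsetP => e; rewrite in_fsetD1 in_fsetU => /andP[ne eK].
  have e12 := simple_K eK.
  have [ib|ib] := boolP (inc b e).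
  + apply/orP; right; apply: in_K_inc => // x xe; have := K_inc eK xe.
    rewrite !in_fset1U => /or3P[->//|/eqP xa|->]; last by rewrite orbT.
    rewrite xa in xe; case/eqP: ne; apply: inc_edge => //; by rewrite eq_sym.
  + apply/orP; left; apply: in_K_inc => // x xe; have := K_inc eK xe.
    by rewrite in_fset1U => /orP[/eqP xb|//]; rewrite xb (negbTE ib) in xe.
Qed.

(** By concavity the increments of [krank] eventually do not increase, so they become constant;
    strict growth makes the constant positive. *)
Lemma krank_eventually_linear c : (forall G, sg G -> k_connected c G -> rigid fam G) ->
  exists d n0, 0 < d /\ forall n, n0 <= n -> krank n.+1 = krank n + d.
Proof.
move=> hLY; have [|n0 h1 h2] := @nonincreasing_eventually_const
    (fun n => krank n.+1 - krank n) (c + 2).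
  move=> n hn; have := krank_concave hLY hn.
  have := krank_mono gmf (leqnSn n); have := krank_mono gmf (leqnSn n.+1); lia.
exists (krank n0.+1 - krank n0), n0; split.
- by have := @krank_lt _ gmf unb n0; lia.
- by move=> n /h2 <-; rewrite subnKC //; apply: krank_mono.
Qed.

Variables d n0 : nat.
Hypothesis krankS : forall n, n0 <= n -> krank n.+1 = krank n + d.

Lemma krankD n k : n0 <= n -> krank (n + k) = krank n + k * d.
Proof.
move=> hn; elim: k => [|k IH]; first by rewrite addn0 mul0n addn0.
by rewrite addnS krankS ?IH ?mulSn; lia.
Qed.

(* M(K_{W+v}) / K_W is invariant under permutations of W, hence uniform of rank d. *)
Lemma rank_star_lt F v u U : sg F -> v \notin V F -> v \notin U -> u \notin U -> u != v ->
  #|` U| < d -> r (F `|` star v U) < r (mkedge u v |` (F `|` star v U)).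
Proof.
move=> sF vF vU uU uv cU.
have sX : sg (F `|` star v U) by apply: simple_U => //; apply: simple_star.
have uv12 := mkedge_lt uv.
rewrite ltn_neqAle; apply/andP; split; last first.
  by apply: (rank_mono gmf); [apply: simple_1U|apply: fsubsetUr].
apply/eqP => /esym h.
(* The padding makes [W] large enough for [krankS]. *)
set W0 := v |` (u |` (V F `|` U)).
have [W' s' cW'] := @fset_extend W0 (#|` W0| + n0.+1) (leq_addr _ _).
have vW' : v \in W' by apply: (fsubsetP s'); rewrite fset1U1.
pose W := W' `\ v; have vW : v \notin W by rewrite !inE eqxx.
have inW x : x != v -> x \in W0 -> x \in W.
  by move=> xv /(fsubsetP s') xW'; rewrite in_fsetD1 xv.
have cW : n0 <= #|` W| by have := cardfsD1 v W'; rewrite vW' -/W; lia.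
have uW : u \in W by apply: inW => //; rewrite !inE eqxx ?orbT.
have UW : U `<=` W.
  apply/fsubsetP => x xU; apply: inW; first by apply: contraNneq vU => <-.
  by rewrite !in_fset1U in_fsetU xU !orbT.
have FW : V F `<=` W.
  apply/fsubsetP => x xU; apply: inW; first by apply: contraNneq vF => <-.
  by rewrite !in_fset1U in_fsetU xU !orbT.
pose X := K W `|` star v U.
have sXX : sg X by apply: simple_U; [exact: simple_K|exact: simple_star].
have hX : r (mkedge u v |` X) = r X.
  by apply: (@rank_1_mono _ gmf (F `|` star v U)) => //; apply: fsetSU; apply: sub_K.
(* Transposing [u] with a vertex of [W] outside [U] preserves [X], so once [uv] is spanned, all
   edges from [v] to [W] are. Then [v] would raise the rank of [K W] by at most the size of [U],
   which is less than [d]. *)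
have spanned : r (X `|` K (v |` W)) = r X.
  apply: (rank_closure gmf) => // [|e eK]; first exact: simple_K.
  have inX f : f \in X -> r (f |` X) = r X.
    by move=> fX; congr r; apply/fsetUidPr; rewrite fsub1set.
  have [eW|neW] := boolP (e \in K W); first by apply: inX; rewrite in_fsetU eW.
  have [w wW ->] := K_1U_edge eK neW vW.
  have [wU|wU] := boolP (w \in U).
    by apply: inX; rewrite in_fsetU mkedgeC mkedge_star wU orbT.
  have wv : w != v by apply: contraNneq vW => <-.
  apply: (@rank_edge_swap _ gmf _ u) => //.
  rewrite /X imfsetU emap_K; last by move=> x y _ _; apply: swap_inj.
  rewrite swap_fset //; congr (_ `|` _).
  have fix_star x : x \in U -> emap (swap u w) (mkedge v x) = mkedge v x.
    move=> xU; rewrite emap_mkedge !swap_id // 1?eq_sym //.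
    - by apply: contraNneq uU => ->.
    - by apply: contraNneq wU => ->.
  apply/fsetP => f; apply/imfsetP/idP => [[g /= /in_starP[x xU ->] ->]|].
  - by rewrite fix_star // mkedge_star.
  - by case/in_starP=> x xU ->; exists (mkedge v x); rewrite /= ?mkedge_star ?fix_star.
have : r (K (v |` W)) <= r (K W) + #|` star v U|.
  apply: leq_trans (rank_U_le gmf (@simple_K _) (simple_star vU)); rewrite -/X -spanned.
  by apply: (rank_mono gmf); [apply: simple_U => //; exact: simple_K|apply: fsubsetUr].
have cvW : #|` v |` W| = (#|` W|).+1 by rewrite cardfsU1 vW.
by rewrite card_star !krankE // cvW krankS //; lia.
Qed.

(** Insert the edges one at a time: each raises the rank as long as fewer than [d] are present. *)
Lemma rank_star_ge F v U : sg F -> v \notin V F -> v \notin U ->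
  r F + minn #|` U| d <= r (F `|` star v U).
Proof.
move=> sF vF; have [m] := ubnP #|` U|; elim: m U => // m IH U cU vU.
have sX := simple_U sF (simple_star vU).
have [U0|[u uU]] := fset_0Vmem U.
  by rewrite U0 cardfs0 min0n addn0; apply: (rank_mono gmf); rewrite -?U0 ?fsubsetUl.
have cD := cardfsD1 u U; rewrite uU in cD.
have vD : v \notin U `\ u by rewrite in_fsetD1 (negbTE vU) andbF.
have mono Y : Y `<=` U -> r (F `|` star v Y) <= r (F `|` star v U).
  move=> sY; apply: (rank_mono gmf) => //; apply: fsetUS; exact: imfset_sub.
have := IH (U `\ u) _ vD; have -> : #|` U `\ u| < m by lia.
move=> /(_ isT) h; have [le|lt] := leqP d #|` U `\ u|.
  have := mono _ (fsubsetDl U [fset u]); lia.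
have uv : u != v by apply: contraNneq vU => <-.
have := @rank_star_lt F v u (U `\ u) sF vF vD _ uv lt.
rewrite fsetD11 => /(_ isT).
have : r (mkedge u v |` (F `|` star v (U `\ u))) <= r (F `|` star v U).
  apply: (rank_mono gmf) => //; rewrite fsubUset fsub1set in_fsetU mkedgeC mkedge_star uU orbT /=.
  by apply: fsetUS; apply: imfset_sub; apply: fsubsetDl.
lia.
Qed.

(** * Attaching several new vertices *)

Definition grow (U : nat -> {fset nat}) (F : {fset edge}) (s : seq nat) :=
  foldr (fun y F => F `|` star y (U y)) F s.

Lemma grow_sub U F s A : F `<=` A -> (forall y, y \in s -> star y (U y) `<=` A) ->
  grow U F s `<=` A.
Proof.
move=> sF; elim: s => //= y s IH h; rewrite fsubUset h ?mem_head // andbT.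
by apply: IH => z zs; apply: h; rewrite inE zs orbT.
Qed.

(** No [U y] meets [s], so each vertex is still new when its star is attached. *)
Lemma rank_grow U F s : sg F -> uniq s ->
  (forall y, y \in s -> y \notin V F) ->
  (forall y z, y \in s -> z \in s -> z \notin U y) ->
  r F + \sum_(y <- s) minn #|` U y| d <= r (grow U F s).
Proof.
move=> sF us hF hU.
(* The induction carries a bound on the vertex set, which shows that the next vertex is new. *)
suff [] : sg (grow U F s) /\ (forall x, x \in V (grow U F s) ->
    [\/ x \in V F, x \in s | exists2 y, y \in s & x \in U y]) /\
    r F + \sum_(y <- s) minn #|` U y| d <= r (grow U F s) by move=> _ [].
elim: s us hF hU => [|y s IH] /=.
  by move=> *; rewrite big_nil addn0; split=> //; split=> // x; constructor.
case/andP=> ys us hF hU.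
have [|| sg_s [V_s r_s]] := IH us.
- by move=> z zs; apply: hF; rewrite inE zs orbT.
- by move=> z w zs ws; apply: hU; rewrite inE ?zs ?ws orbT.
have yU : y \notin U y by apply: hU; rewrite inE eqxx.
split; first by apply: simple_U => //; apply: simple_star.
split.
- move=> x; rewrite V_U in_fsetU => /orP[/V_s[h|h|[z zs h]]|/(fsubsetP (V_star _ _))].
  + by constructor 1.
  + by constructor 2; rewrite inE h orbT.
  + by constructor 3; exists z; rewrite // inE zs orbT.
  + rewrite in_fset1U => /orP[/eqP->|h]; first by constructor 2; rewrite inE eqxx.
    by constructor 3; exists y; rewrite // inE eqxx.
- have yV : y \notin V (grow U F s).
    apply/negP => /V_s[].
    + by apply/negP; apply: hF; rewrite inE eqxx.
    + by apply/negP.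
    + by case=> z zs; apply/negP; apply: hU; rewrite inE ?zs ?eqxx ?orbT.
  by apply: leq_trans (rank_star_ge sg_s yV yU); rewrite big_cons addnCA addnC leq_add2r.
Qed.

(* With X' = V1 :&: V2 padded to a large set, K_(V1 + X') and K_(V2 + X') form a modular pair. *)
Lemma rank_cut V1 V2 A B k : #|` V1 `&` V2| <= k -> sg A -> sg B -> V A `<=` V1 -> V B `<=` V2 ->
  r A + r B <= r (A `|` B) + krank (n0 + d + k).
Proof.
(* [N] is at least [n0] for linearity, at least [d] so that joining a vertex to [X'] adds [d], and
   at least [k] so that [X] can be padded to size [N]. *)
move=> cX sA sB sVA sVB; set N := n0 + d + k; set X := V1 `&` V2 in cX.
have [W' sW' cW'] := @fset_extend (V1 `|` V2) (#|` V1 `|` V2| + (N - #|` X|)) (leq_addr _ _).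
pose X' := (W' `\` (V1 `|` V2)) `|` X.
have inX' x : (x \in V1 `|` V2) -> (x \in X') = (x \in X).
  by move=> h; rewrite in_fsetU in_fsetD h.
have XV x : x \in X -> x \in V1 `|` V2 by rewrite in_fsetI in_fsetU => /andP[->].
have cX' : #|` X'| = N.
  have := cardfsUI (W' `\` (V1 `|` V2)) X.
  have -> : (W' `\` (V1 `|` V2)) `&` X = fset0.
    apply/fsetP => x; rewrite in_fset0 in_fsetI in_fsetD.
    by apply/negP => /andP[/andP[h _] /XV]; rewrite (negbTE h).
  by rewrite cardfs0 cardfsD (fsetIidPr sW') cW' -/X'; lia.
pose P1 := V1 `|` X'; pose P2 := V2 `|` X'; pose T := P2 `\` X'.
have TP1 y : y \in T -> y \notin P1.
  case/fsetDP => /fsetUP[yV2|->//] yX'.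
  apply: contra yX' => /fsetUP[yV1|//].
  by rewrite inX' ?in_fsetU ?in_fsetI ?yV1.
have cP2 : #|` P2| = N + #|` T|.
  by rewrite -cX' addnC cardfsD (fsetIidPr (fsubsetUr _ _)) subnK // fsubset_leq_card ?fsubsetUr.
have sK1 := @simple_K P1; have sK2 := @simple_K P2; have sK := simple_U sK1 sK2.
have h1 : r (K P1) + #|` T| * d <= r (K P1 `|` K P2).
  have := @rank_grow (fun=> X') (K P1) T sK1 (fset_uniq T) _ _.
  rewrite big_const_seq count_predT iter_addn addn0 cX' (minn_idPr _) 1?mulnC; last by rewrite /N; lia.
  move=> h; apply: leq_trans (h _ _) _.
  - by move=> y /TP1; apply: contra; apply/fsubsetP; apply: V_K_sub.
  - by move=> y z _; rewrite in_fsetD => /andP[].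
  - apply: (rank_mono gmf) => //; apply: grow_sub; first exact: fsubsetUl.
    move=> y yT; apply: fsubset_trans (fsubsetUr _ _); apply/fsubsetP => e /in_starP[x xX' ->].
    move: yT; rewrite in_fsetD => /andP[yX' yP2].
    rewrite mkedge_K yP2 in_fsetU xX' orbT !andbT.
    by apply: contraNneq yX' => ->.
have h2 : r (K P2) = krank N + #|` T| * d.
  by rewrite krankE // cP2 krankD // /N; lia.
have sAK1 : A `<=` K P1.
  by apply: sub_K => //; apply: fsubset_trans sVA (fsubsetUl _ _).
have sBK2 : B `<=` K P2.
  by apply: sub_K => //; apply: fsubset_trans sVB (fsubsetUl _ _).
(* Two uses of submodularity bound the defect of [A], [B] by that of [K P1], [K P2], which [h1] and
   [h2] bound by [krank N]. *)
have := @rank_submod _ gmf (A `|` K P2) (K P1) A (K P1 `|` K P2) (simple_U sA sK2) sK1.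
rewrite fsubsetI fsubsetUl sAK1 fsubUset fsubsetUr -fsetUA fsetUCA fsubsetUl.
move=> /(_ isT isT).
have := @rank_submod _ gmf (A `|` B) (K P2) B (A `|` K P2) (simple_U sA sB) sK2.
rewrite fsubsetI fsubsetUr sBK2 fsetSU ?fsubsetUl // => /(_ isT isT).
lia.
Qed.

End Growth.

(** * Reconstruction *)

Lemma mem_head_fset (W : {fset nat}) : W != fset0 -> head 0 W \in W.
Proof.
case/fset0Pn => x xW; have : x \in enum_fset W by [].
change (x \in enum_fset W -> head 0 (enum_fset W) \in enum_fset W).
by case: (enum_fset W) => //= y s _; apply: mem_head.
Qed.

Lemma sum_geq_const (T : eqType) (s : seq T) F m :
  (forall y, y \in s -> m <= F y) -> size s * m <= \sum_(y <- s) F y.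
Proof.
elim: s => [|x s IH] h; first by rewrite big_nil.
rewrite big_cons /= mulSn leq_add ?h ?mem_head // IH // => y ys.
by apply: h; rewrite inE ys orbT.
Qed.

Lemma in_del1 G w e : (e \in del G [fset w]) = (e \in G) && ~~ inc w e.
Proof. by rewrite in_del !in_fset1 /inc negb_or ![w == _]eq_sym. Qed.

Section Reconstruction.
Variable fam : gfamily.
Hypothesis gmf : graph_matroid_family fam.
Hypothesis unb : unbounded fam.
Local Notation r := (rank fam).
Local Notation sg := simple_graph.
Local Notation krank := (krank fam).
Variables c d n0 : nat.
Hypothesis connected_rigid : forall G, sg G -> k_connected c G -> rigid fam G.
Hypothesis d_gt0 : 0 < d.
Hypothesis krankS : forall n, n0 <= n -> krank n.+1 = krank n + d.

Lemma rank_connected G : sg G -> k_connected c G -> r G = krank #|` V G|.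
Proof. by move=> sG kG; rewrite -krankE //; apply: connected_rigid. Qed.

(** [G] and [del G Y] are both rigid, and both orders lie in the linear range of [krank], so each
    deleted vertex costs exactly [d]. *)
Lemma rank_connected_del G Y : sg G -> Y `<=` V G -> k_connected (c + n0 + 1 + #|` Y|) G ->
  r G = r (del G Y) + #|` Y| * d.
Proof.
move=> sG sY kG; have [|eV kD] := k_connected_del sG _ sY kG; first lia.
have kD' : k_connected c (del G Y) by apply: k_connected_le kD; lia.
have kG' : k_connected c G by apply: k_connected_le kG; lia.
rewrite !rank_connected //; last exact: (simple_sub (del_sub _ _) sG).
have -> : #|` V G| = #|` V (del G Y)| + #|` Y|.
  by rewrite eV cardfsD (fsetIidPr sY) subnK // fsubset_leq_card.
by apply: (krankD krankS); case: kD; lia.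
Qed.

(** Reattach the vertices of [Y] by their edges leaving [Y]; no edge inside [Y] is used, hence the
    [K Y] removed on the right. *)
Lemma rank_del_ge A Y : sg A ->
  r (del A Y) + \sum_(y <- Y) minn #|` nbr A y `\` Y| d <= r (A `\` K Y).
Proof.
move=> sA; have sD := simple_sub (del_sub A Y) sA.
have sAK : sg (A `\` K Y) by apply: (simple_sub (fsubsetDl _ _)).
apply: leq_trans (rank_grow gmf krankS (U := fun y => nbr A y `\` Y) sD (fset_uniq Y) _ _) _.
- by move=> y yY; apply/negP => /(fsubsetP (V_del_sub _ _)); rewrite in_fsetD yY.
- by move=> y z yY zY; rewrite in_fsetD zY.
- apply: (rank_mono gmf) => //; apply: grow_sub.
  + apply/fsubsetP => e; rewrite in_del in_fsetD => /and3P[-> h1 h2].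
    by rewrite in_K (negbTE h1).
  + move=> y yY; apply/fsubsetP => e /in_starP[u /fsetDP[uA uY] ->].
    by rewrite in_nbr in uA; rewrite in_fsetD uA mkedge_K (negbTE uY) !andbF.
Qed.

(** Each vertex of [Z] has at least [d] neighbours outside [Z], so reattaching them without edges
    inside [Z] regains all the lost rank. *)
Lemma rank_minus_small G Z : sg G -> Z `<=` V G -> k_connected (c + n0 + d + 1 + #|` Z|) G ->
  r (G `\` K Z) = r G.
Proof.
move=> sG sZ kG; apply/eqP; rewrite eqn_leq (rank_mono gmf sG (fsubsetDl _ _)) /=.
rewrite (rank_connected_del sG sZ); last by apply: k_connected_le kG; lia.
apply: leq_trans (rank_del_ge Z sG); rewrite leq_add2l.
apply: sum_geq_const => z zZ.
have kG' : k_connected (d + #|` Z|) G by apply: k_connected_le kG; lia.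
have := k_connected_nbrD sG kG' (fsubsetP sZ _ zZ); lia.
Qed.

(** Otherwise pick [C.+1] mixed vertices [Y], each with an [A]-neighbour and a [B]-neighbour outside
    [Y]. Deleting [Y] lowers [r A + r B] by at least [d.+1] per vertex but [r G] by only [d], and
    the surplus exceeds [C]. *)
Lemma mixed_small G A B C : sg G -> G = A `|` B -> r A + r B <= r G + C ->
  k_connected (c + n0 + d + 2 + C.+1) G -> #|` V A `&` V B| < 5 * C.+1.
Proof.
move=> sG eG hr kG.
have sA : sg A by apply: (simple_sub _ sG); rewrite eG fsubsetUl.
have sB : sg B by apply: (simple_sub _ sG); rewrite eG fsubsetUr.
(* One neighbour per part is selected; the default 0 of [head] never occurs at a mixed vertex. *)
rewrite ltnNge; apply/negP => /(outdegree2_indep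
  (a := fun z => head 0 (nbr A z)) (b := fun z => head 0 (nbr B z)))[].
  move=> z; rewrite in_fsetI => /andP[zA zB]; split.
  - have := mem_head_fset (nbr_neq0 sA zA).
    by apply: contraTneq => ->; apply: notin_nbr.
  - have := mem_head_fset (nbr_neq0 sB zB).
    by apply: contraTneq => ->; apply: notin_nbr.
move=> Y [sY cY hY].
have YG : Y `<=` V G.
  apply: fsubset_trans sY _; apply: fsubset_trans (fsubsetIl _ _) _.
  by apply: V_sub; rewrite eG fsubsetUl.
have kY : k_connected (c + n0 + 1 + #|` Y|) G by apply: k_connected_le kG; rewrite cY; lia.
have kY' : k_connected (d.+1 + #|` Y|) G by apply: k_connected_le kG; rewrite cY; lia.
have rG := rank_connected_del sG YG kY.
have hA := leq_trans (rank_del_ge Y sA) (rank_mono gmf sA (fsubsetDl A (K Y))).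
have hB := leq_trans (rank_del_ge Y sB) (rank_mono gmf sB (fsubsetDl B (K Y))).
have hD : r (del G Y) <= r (del A Y) + r (del B Y).
  apply: leq_trans (leq_addr (r fset0) _) _; apply: (rank_submod gmf).
  - exact: (simple_sub (del_sub _ _) sA).
  - exact: (simple_sub (del_sub _ _) sB).
  - exact: fsub0set.
  - by apply/fsubsetP => e; rewrite in_fsetU !in_del eG in_fsetU -andb_orl.
(* Both counts are positive and together at least [d.+1]; truncating each at [d > 0] preserves that
   bound. *)
have hS : #|` Y| * d.+1 <= \sum_(y <- Y) (minn #|` nbr A y `\` Y| d + minn #|` nbr B y `\` Y| d).
  apply: sum_geq_const => y yY; have [hyA hyB] := hY y yY.
  have := fsubsetP sY y yY; rewrite in_fsetI => /andP[yA yB].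
  have posA : 0 < #|` nbr A y `\` Y|.
    rewrite cardfs_gt0; apply/fset0Pn; exists (head 0 (nbr A y)).
    by rewrite in_fsetD hyA mem_head_fset // nbr_neq0.
  have posB : 0 < #|` nbr B y `\` Y|.
    rewrite cardfs_gt0; apply/fset0Pn; exists (head 0 (nbr B y)).
    by rewrite in_fsetD hyB mem_head_fset // nbr_neq0.
  have := k_connected_nbrD sG kY' (fsubsetP YG _ yY).
  have sub : nbr G y `\` Y `<=` (nbr A y `\` Y) `|` (nbr B y `\` Y).
    by apply/fsubsetP => x; rewrite in_fsetU !in_fsetD !in_nbr eG in_fsetU -andb_orr.
  have := fsubset_leq_card sub; have := cardfsUI (nbr A y `\` Y) (nbr B y `\` Y).
  move: posA posB; lia.
rewrite big_split /= cY in hS; rewrite cY in rG.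
move: hA hB hS; set sA' := \sum_(y <- Y) _; set sB' := \sum_(y <- Y) _.
rewrite mulnS => hA hB hS; move: rG hr hA hB hS hD; set x := C.+1 * d; lia.
Qed.

(** Every edge lies in [A] or [B], so none joins [V A] minus [Z] to the rest outside [Z]. As [Z] is
    too small to separate [G], one side is empty. *)
Lemma separation_inside k G A B : G = A `|` B -> sg G -> k_connected k G ->
  #|` V A `&` V B| < k -> A `<=` K (V A `&` V B) \/ B `<=` K (V A `&` V B).
Proof.
move=> eG sG [_ kG]; set Z := V A `&` V B => cZ.
have sA : sg A by apply: (simple_sub _ sG); rewrite eG fsubsetUl.
have sB : sg B by apply: (simple_sub _ sG); rewrite eG fsubsetUr.
have eV : V G = V A `|` V B by rewrite eG V_U.
have sZ : Z `<=` V G by rewrite eV; apply: fsubset_trans (fsubsetIl _ _) (fsubsetUl _ _).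
have [S0|S0] := eqVneq (V A `\` Z) fset0.
  by left; apply: sub_K => //; rewrite -fsetD_eq0 S0.
have [SW|SW] := eqVneq (V A `\` Z) (V G `\` Z).
  right; apply: sub_K => //; apply/fsubsetP => x xB; apply/negPn/negP => xZ.
  have : x \in V G `\` Z by rewrite in_fsetD xZ eV in_fsetU xB orbT.
  by rewrite -SW in_fsetD => /andP[_ xA]; rewrite in_fsetI xA xB in xZ.
have sS : V A `\` Z `<=` V G `\` Z by apply: fsetSD; rewrite eV fsubsetUl.
have [u [v [/fsetDP[uA uZ] /fsetDP[/fsetDP[vG vZ] vS]]]] := kG Z sZ cZ _ sS S0 SW.
rewrite eG in_fsetU => /orP[] /in_V_edge/andP[hu hv].
- by rewrite in_fsetD vZ hv in vS.
- by rewrite in_fsetI uA hu in uZ.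
Qed.

(** [krank (n0 + d + c)] is the rank defect allowed across a cut of at most [c] vertices, and five
    times its successor bounds the number of mixed vertices. The other terms serve rigidity,
    linearity and degrees after deletions. *)
Definition recon_const := c + n0 + d + 2 + 5 * (krank (n0 + d + c)).+1.

(** * Transferring connectivity and order along a matroid isomorphism *)

Section Iso.
Variables (G H : {fset edge}) (psi : edge -> edge).
Hypotheses (sG : sg G) (sH : sg H) (iso : matroid_iso fam G H psi).

(** If the star of [w] came entirely from [K Z], deleting [w] from [H] would keep the full rank,
    since [G] minus [K Z] has it. But [w] has an edge and [d > 0], so the rank drops. *)
Lemma iso_star_not_inside Z w : Z `<=` V G -> k_connected (c + n0 + d + 1 + #|` Z|) G ->
  w \in V H -> exists e, [/\ e \in G, inc w (psi e) & e \notin K Z].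
Proof.
move=> sZ kG wH.
have [/hasP[e eG /andP[h1 h2]]|/hasPn h] := boolP (has (fun e => inc w (psi e) && (e \notin K Z)) G).
  by exists e.
have hr : r G <= r (del H [fset w]).
  rewrite -(rank_minus_small sG sZ kG) (matroid_iso_rank_sub gmf sG sH iso (fsubsetDl _ _)).
  apply: (rank_mono gmf); first exact: (simple_sub (del_sub _ _) sH).
  apply/fsubsetP => f /imfsetP[e /= /fsetDP[eG eZ] ->].
  have [_ [im _]] := iso; rewrite in_del1 -im in_imfset //=.
  by have := h e eG; rewrite eZ andbT.
have := leq_trans (rank_del_ge [fset w] sH) (rank_mono gmf sH (fsubsetDl H _)).
rewrite big_seq_fset1 -(matroid_iso_rank gmf sG sH iso).
suff : 0 < #|` nbr H w `\` [fset w]| by lia.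
have /fset0Pn[x xw] := nbr_neq0 sH wH; rewrite cardfs_gt0; apply/fset0Pn; exists x.
by rewrite in_fsetD xw andbT in_fset1; apply: contraTneq xw => ->; apply: notin_nbr.
Qed.

Hypothesis kG : k_connected recon_const G.

Lemma krank_le_inv m n : 1 < n -> krank n <= krank m -> n <= m.
Proof.
move=> n1; rewrite [n <= m]leqNgt => h; apply/negP => lt; move: h.
(* The case [m = 0] is separate because strict growth of [krank] starts at 1. *)
have [m0|m0] := posnP m; last by have := krank_ltn gmf unb m0 lt; lia.
have := krank_ltn gmf unb (ltn0Sn 0) n1; have := krank_mono gmf (leqnSn m).
by rewrite m0; lia.
Qed.

Lemma iso_card_le : #|` V G| <= #|` V H|.
Proof.
have kGc : k_connected c G by apply: k_connected_le kG; rewrite /recon_const; lia.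
apply: krank_le_inv; first by case: kG; rewrite /recon_const; lia.
rewrite -rank_connected // (matroid_iso_rank gmf sG sH iso) -(krankE gmf).
by apply: (rank_mono gmf); [apply: simple_K|apply: sub_K].
Qed.

Lemma iso_connected : k_connected c H.
Proof.
have cVG := kG.1; rewrite /recon_const in cVG.
split; first by have := iso_card_le; lia.
move=> X sX cX S sS S0 SW; set W := V H `\` X in sS SW *.
have [/hasP[e eH he]|/hasPn h] := boolP (has (fun e : edge =>
    ((e.1 \in S) && (e.2 \in W `\` S)) || ((e.2 \in S) && (e.1 \in W `\` S))) H).
  have ee := mkedgeE (sH eH); case/orP: he => /andP[h1 h2].
  - by exists e.1, e.2; rewrite -ee.
  - by exists e.2, e.1; rewrite mkedgeC -ee.
exfalso.
(* No edge joins [S] to [W] minus [S], so edges meeting [S] and the other edges share only vertices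
   of [X]. *)
pose A := [fset e in H | (e.1 \in S) || (e.2 \in S)].
pose B := [fset e in H | (e.1 \notin S) && (e.2 \notin S)].
have inA e : (e \in A) = (e \in H) && ((e.1 \in S) || (e.2 \in S)) by rewrite in_fset.
have inB e : (e \in B) = (e \in H) && ((e.1 \notin S) && (e.2 \notin S)) by rewrite in_fset.
have sAH : A `<=` H by apply: fset_sub.
have sBH : B `<=` H by apply: fset_sub.
have eH : H = A `|` B.
  apply/fsetP => e; rewrite in_fsetU inA inB.
  by case: (e \in H); case: (e.1 \in S); case: (e.2 \in S).
have VH e : e \in H -> (e.1 \in V H) && (e.2 \in V H).
  by move=> eHH; apply: in_V_edge; rewrite -mkedgeE //; apply: sH.
have VA : V A `<=` S `|` X.
  apply/fsubsetP => x /in_VP[e]; rewrite inA => /andP[eHH eS] xe.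
  have := h e eHH; have /andP[v1 v2] := VH e eHH.
  rewrite /W !in_fsetD v1 v2 (in_fsetU S X).
  case/orP: xe => /eqP->; move: eS; case: (e.1 \in S); case: (e.2 \in S);
  by case: (e.1 \in X); case: (e.2 \in X).
have VB : V B `<=` V H `\` S.
  apply/fsubsetP => x /in_VP[e]; rewrite inB => /andP[eHH /andP[e1 e2]] xe.
  have /andP[v1 v2] := VH e eHH; rewrite in_fsetD.
  by case/orP: xe => /eqP->; rewrite ?e1 ?e2 ?v1 ?v2.
have cI : #|` (S `|` X) `&` (V H `\` S)| <= c.
  apply: leq_trans (ltnW cX); apply: fsubset_leq_card; apply/fsubsetP => x.
  by rewrite in_fsetI in_fsetU in_fsetD => /andP[/orP[->|]].
have hcut := rank_cut gmf krankS cI (simple_sub sAH sH) (simple_sub sBH sH) VA VB.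
rewrite -eH -(matroid_iso_rank gmf sG sH iso) in hcut.
have [inj [im _]] := iso.
have preim F : F `<=` H -> [fset psi e | e in [fset e in G | psi e \in F]] = F.
  move=> sF; apply/fsetP => f; apply/imfsetP/idP => [[e /=]|fF].
  - by rewrite in_fset /= => /andP[_ h1] ->.
  - have := fsubsetP sF _ fF; rewrite -im => /imfsetP[e /= eG ef].
    by exists e; rewrite // in_fset /= inE eG -ef.
(* The split is pulled back to [G], where few vertices can be mixed. *)
pose A' := [fset e in G | psi e \in A]; pose B' := [fset e in G | psi e \in B].
have inA' e : (e \in A') = (e \in G) && (psi e \in A) by rewrite in_fset.
have inB' e : (e \in B') = (e \in G) && (psi e \in B) by rewrite in_fset.
have eG : G = A' `|` B'.
  apply/fsetP => e; rewrite in_fsetU inA' inB' -andb_orr -in_fsetU -eH.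
  apply/idP/andP => [eGG|[]//]; split=> //; by rewrite -im in_imfset.
have rA : r A' = r A.
  by rewrite (matroid_iso_rank_sub gmf sG sH iso (fset_sub _ _)) preim.
have rB : r B' = r B.
  by rewrite (matroid_iso_rank_sub gmf sG sH iso (fset_sub _ _)) preim.
rewrite -rA -rB in hcut.
have cZ : #|` V A' `&` V B'| < 5 * (krank (n0 + d + c)).+1.
  by apply: mixed_small eG hcut _ => //; apply: k_connected_le kG; rewrite /recon_const; lia.
have sZ : V A' `&` V B' `<=` V G.
  by apply: fsubset_trans (fsubsetIl _ _) _; apply: V_sub; apply: fset_sub.
have kZ : k_connected (c + n0 + d + 1 + #|` V A' `&` V B'|) G.
  by apply: k_connected_le kG; rewrite /recon_const; lia.
(* Neither part fits inside the mixed vertices: [A] contains the full star of any vertex of [S], and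
   [B] that of any vertex of [W] minus [S]. *)
have [|sub|sub] := separation_inside eG sG kG; first by rewrite /recon_const; lia.
- have /fset0Pn[w wS] := S0.
  have wH : w \in V H by have := fsubsetP sS _ wS; rewrite in_fsetD => /andP[].
  have [e [eGG we]] := iso_star_not_inside sZ kZ wH; case/negP.
  apply: (fsubsetP sub); rewrite inA' eGG inA -im in_imfset //=.
  by case/orP: we => /eqP <-; rewrite wS ?orbT.
- have /fset0Pn[w wD] : W `\` S != fset0.
    by apply: contraNneq SW => /eqP; rewrite fsetD_eq0 eqEfsubset sS => ->.
  case/fsetDP: wD => /fsetDP[wH wX] wS.
  have [e [eGG we]] := iso_star_not_inside sZ kZ wH; case/negP.
  apply: (fsubsetP sub); rewrite inB' eGG.
  have : psi e \in H by rewrite -im in_imfset.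
  rewrite eH in_fsetU => /orP[eA|//]; exfalso.
  have : w \in S `|` X by apply: (fsubsetP VA); apply/in_VP; exists (psi e).
  by rewrite in_fsetU (negbTE wS) (negbTE wX).
Qed.

Lemma iso_card : #|` V H| = #|` V G|.
Proof.
apply/eqP; rewrite eqn_leq iso_card_le andbT.
have kGc : k_connected c G by apply: k_connected_le kG; rewrite /recon_const; lia.
apply: krank_le_inv.
- by apply: leq_trans iso_card_le; case: kG; rewrite /recon_const; lia.
- rewrite -(rank_connected sH iso_connected) -(matroid_iso_rank gmf sG sH iso).
  by rewrite rank_connected.
Qed.

End Iso.

(** * Recovering the vertex map from stars *)

(** Comparing orders for [G] and [G - v] shows that the image of [G - v] misses exactly one vertex
    [w], so edges at [w] come from edges at [v]. The extra 1 in connectivity pays for deleting [v].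
    The explicit [w] later defines a function without choice. *)
Lemma iso_star G H psi v : sg G -> sg H -> matroid_iso fam G H psi ->
  k_connected recon_const.+1 G -> v \in V G ->
  let w := head 0 (V H `\` V [fset psi e | e in del G [fset v]]) in
  w \in V H /\ forall e, e \in G -> inc w (psi e) = inc v e.
Proof.
move=> sG sH iso kG vG; set Gv := del G [fset v]; set Hv := [fset psi e | e in Gv] => w.
have [inj [im _]] := iso.
have kG' : k_connected recon_const G by apply: k_connected_le kG; lia.
have sv : [fset v] `<=` V G by rewrite fsub1set.
have [||eV kGv] := @k_connected_del recon_const G [fset v] sG _ sv.
- by rewrite /recon_const; lia.
- by rewrite cardfs1 addn1.
have kGvc : k_connected c Gv by apply: k_connected_le kGv; rewrite /recon_const; lia.
have sGv : Gv `<=` G by apply: del_sub.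
have sgv := simple_sub sGv sG.
have sHv : Hv `<=` H by rewrite -im; apply: imfset_sub.
have sghv := simple_sub sHv sH.
have cHv := iso_card sgv sghv (matroid_iso_sub gmf sG sH iso sGv) kGv.
have cH := iso_card sG sH iso kG'.
have cD : #|` V H `\` V Hv| = 1.
  rewrite cardfsD (fsetIidPr (V_sub sHv)) cH cHv eV cardfsD (fsetIidPr sv) cardfs1.
  by case: kG'; rewrite /recon_const; lia.
have /fsetDP[wH wHv] : w \in V H `\` V Hv by apply: mem_head_fset; rewrite -cardfs_gt0 cD.
have only x : x \in V H -> x != w -> x \in V Hv.
  move=> xH; apply: contraNT => xHv; move/eqP: cD => /cardfs1P[z ez].
  have : x \in V H `\` V Hv by rewrite in_fsetD xHv.
  have : w \in V H `\` V Hv by rewrite in_fsetD wHv.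
  by rewrite ez !in_fset1 => /eqP -> /eqP ->.
have psiH e : e \in G -> psi e \in H by move=> eG; rewrite -im in_imfset.
split=> // e eG; have [ve|ve] := boolP (inc v e); last first.
  apply: contraNF wHv => we; apply/in_VP; exists (psi e) => //.
  by rewrite in_imfset //= in_del1 eG.
apply/negPn/negP => we.
have [u uv ee] := inc_other (sG _ eG) ve; rewrite mkedgeC in ee.
have uGv : u \in V Gv.
  by rewrite eV in_fsetD in_fset1 uv; rewrite ee in eG; case/andP: (in_V_edge eG).
have vGv : v \notin V Gv by rewrite eV in_fsetD in_fset1 eqxx.
(* An edge at [v] sent away from [w] would fall inside [V Hv], where [Hv] already has full rank; yet
   in [G] it is pendant to [G - v] and raises the rank. *)
have := rank_pendant gmf unb sgv uGv vGv; rewrite -ee ltnNge => /negP; apply.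
have sub : e |` Gv `<=` G by rewrite fsubUset fsub1set eG.
rewrite (matroid_iso_rank_sub gmf sG sH iso sub) (rank_connected sgv kGvc) -cHv -krankE //.
apply: (rank_mono gmf); first exact: simple_K.
apply/fsubsetP => f /imfsetP[g /= gG ->]; apply: in_K_inc.
  by apply: sH; apply: psiH; apply: (fsubsetP sub).
move=> x xg; case/fset1UP: gG => [ge|gGv].
- rewrite ge in xg; apply: only; first by apply/in_VP; exists (psi e) => //; apply: psiH.
  by apply: contraNneq we => <-.
- by apply/in_VP; exists (psi g) => //; rewrite in_imfset.
Qed.

Lemma connected_reconstructible G : sg G -> k_connected recon_const.+1 G -> reconstructible fam G.
Proof.
move=> sG kG H psi sH iso.
pose phi v := head 0 (V H `\` V [fset psi e | e in del G [fset v]]).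
have hphi v : v \in V G -> phi v \in V H /\ forall e, e \in G -> inc (phi v) (psi e) = inc v e.
  by move=> vG; apply: iso_star.
have [_ [im _]] := iso.
have kG' : k_connected recon_const G by apply: k_connected_le kG; lia.
have inj : {in V G &, injective phi}.
  (* A neighbour [x] of [u] other than [v] gives an edge that meets [u] but not [v], although its
     image meets the common value of [phi]. *)
  move=> u v uG vG euv; apply/eqP/negPn/negP => uv.
  have kG1 : k_connected (1 + #|` [fset v]|) G.
    by apply: k_connected_le kG; rewrite cardfs1 /recon_const; lia.
  have := k_connected_nbrD sG kG1 uG; rewrite cardfs_gt0 => /fset0Pn[x].
  rewrite in_fsetD in_nbr in_fset1 => /andP[xv ux].
  have := (hphi v vG).2 _ ux; rewrite -euv (hphi u uG).2 // !inc_mkedge eqxx /=.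
  by rewrite ![v == _]eq_sym (negbTE uv) (negbTE xv).
have psiE u v : u \in V G -> v \in V G -> mkedge u v \in G ->
    psi (mkedge u v) = mkedge (phi u) (phi v).
  move=> uG vG uv; apply: inc_edge.
  - by apply: sH; rewrite -im in_imfset.
  - by have := mkedge_neq sG uv; apply: contra => /eqP/inj -> //.
  - by rewrite (hphi u uG).2 // inc_mkedge eqxx.
  - by rewrite (hphi v vG).2 // inc_mkedge eqxx orbT.
exists phi; split; last by move=> u v; apply: psiE.
split=> //; split.
- have cim : #|` [fset phi x | x in V G]| = #|` V G| by apply: card_in_imfset.
  apply/eqP; rewrite eqEfcard cim (iso_card sG sH iso kG') leqnn andbT.
  by apply/fsubsetP => y /imfsetP[x /= xG ->]; case: (hphi x xG).
(* Conversely, an edge of [H] joining [phi u] and [phi v] is the image of an edge incident with both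
   [u] and [v], which must be [uv]. *)
- move=> u v uG vG; apply/idP/idP => uv; first by rewrite -psiE // -im in_imfset.
  have ne := mkedge_neq sH uv.
  move: (uv); rewrite -im => /imfsetP[e /= eG ee].
  have nuv : u != v by apply: contraNneq ne => ->.
  have <- : e = mkedge u v; last by [].
  apply: inc_edge => //; first exact: sG.
  + by rewrite -(hphi u uG).2 // -ee inc_mkedge eqxx.
  + by rewrite -(hphi v vG).2 // -ee inc_mkedge eqxx orbT.
Qed.

End Reconstruction.

Theorem theorem1p1 (fam : gfamily) :
  graph_matroid_family fam -> unbounded fam ->
  (whitney_property fam <-> lovasz_yemini_property fam).
Proof.
move=> gmf unb; split; first exact: whitney_lovasz_yemini.
case=> c hc; have [d [n0 [d_gt0 hd]]] := krank_eventually_linear gmf unb hc.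
exists (recon_const fam c d n0).+1 => G sG kG.
exact: (connected_reconstructible gmf unb hc d_gt0 hd sG kG).
Qed.
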